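(* Let $2\le q\le p<\infty$ and $s\in\mathbb{N}$. For $i=1,\dots,s$ let $\Omega_i$ be a compact set (in some Euclidean space) with a probability measure $\mu_i$, and let $X(N_i,i)\subset\mathcal{C}(\Omega_i)$ be a subspace with $\dim X(N_i,i)=N_i$ such that $$\|f\|_\infty\le B_iN_i^{1/q}\|f\|_q\quad\text{for all } f\in X(N_i,i),\quad i=1,\dots,s,$$ where $B_i\ge1$. Then for a large enough constant $C=C(p,q,s)$ (depending only on $p,q,s$) there exists a set $\xi(m)=\{\xi^j\}_{j=1}^m\subset\Omega:=\Omega_1\times\cdots\times\Omega_s$ with a tensor product structure of $$m\le C\prod_{i=1}^sB_i^pN_i^{p/q}(\log_2(2B_iN_i))^3$$ points such that for any $f\in\mathbf{X}_{\mathbf{N}}$ $$\left(\frac12\right)^s\|f\|_p^p\le\frac1m\sum_{j=1}^m|f(\xi^j)|^p\le\left(\frac32\right)^s\|f\|_p^p.$$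
   Context: $\mathbf{N}:=(N_1,\dots,N_s)$ and $\mathbf{X}_{\mathbf{N}}:=\operatorname{span}\{f_1(\mathbf{x}^1)\times\cdots\times f_s(\mathbf{x}^s):\ f_i\in X(N_i,i),\ i=1,\dots,s\}\subset\mathcal{C}(\Omega_1\times\cdots\times\Omega_s)$. On $\Omega$ one uses the product measure $\mu=\mu_1\times\cdots\times\mu_s$. For functions on $\Omega$ (resp. $\Omega_i$), $\|f\|_p$ is the $L_p$ norm with respect to $\mu$ (resp. $\mu_i$), and $\|f\|_\infty$ is the uniform norm. A point set $\xi(m)$ has a tensor product structure if $\xi(m)=\xi(m_1,1)\times\cdots\times\xi(m_s,s)$, where $\xi(m_i,i)$ is a family of $m_i$ points of $\Omega_i$ and $m=\prod_i m_i$. Repetitions among points are allowed. *)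

(* Defs.v *)
From HB Require Import structures.
From mathcomp Require Import all_boot all_order all_algebra.
From mathcomp Require Import all_classical all_reals all_analysis.
From mathcomp.real_closed Require Import complex.
Set Implicit Arguments.
Unset Strict Implicit.
Unset Printing Implicit Defensive.
Import Order.TTheory GRing.Theory Num.Theory.
Import numFieldNormedType.Exports.

Local Open Scope classical_set_scope.
Local Open Scope ring_scope.

(* C(Omega) is read both as the space of real-valued and as the space of
   complex-valued continuous functions; results quantify over the two kinds. *)
Variant scalar_kind := RealScalars | ComplexScalars.

Definition scalar_field (R : realType) (k : scalar_kind) : numFieldType :=
  match k with RealScalars => R | ComplexScalars => R[i] end.

(* The norm of a numFieldType is valued in the field itself, hence this
   R-valued version. *)
Definition modulus (R : realType) (k : scalar_kind) : scalar_field R k -> R :=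
  match k with
  | RealScalars => fun x : R => `|x|
  | ComplexScalars => fun z : R[i] => Normc.normc z
  end.

(* Nonemptiness is automatic once a probability measure is given; it is a
   field because measurableType instances must be pointed. *)
Record compact_domain (R : realType) := CompactDomain {
  dom_dim : nat ;
  dom_set : set 'rV[R]_dom_dim ;
  dom_compact : compact dom_set ;
  dom_nonempty : dom_set !=set0 }.

Arguments dom_set {R} c _ : rename.

Definition points (R : realType) (A : compact_domain R) : Type :=
  set_type (dom_set A).

HB.instance Definition _ (R : realType) (A : compact_domain R) :=
  Topological.copy (points A) (set_type (dom_set A)).

Lemma points_inhabited (R : realType) (A : compact_domain R) :
  inhabited (points A).
Proof. by case: (dom_nonempty A) => x Ax; constructor; exists x; exact/mem_set. Qed.

HB.instance Definition _ (R : realType) (A : compact_domain R) :=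
  isPointed.Build (points A) (inhabited_witness (points_inhabited A)).

Definition borel (T : ptopologicalType) := g_sigma_algebraType (@open T).

Section Products.
Context (s : nat) (d : 'I_s -> measure_display).
Context (T : forall i, measurableType (d i)).

Definition box (A : forall i, set (T i)) : set (forall i, T i) :=
  [set x | forall i, A i (x i)].

Definition measurable_boxes : set (set (forall i, T i)) :=
  [set box A | A in [set A | forall i, measurable (A i)]].

Definition product_space := g_sigma_algebraType measurable_boxes.

(* By the pi-lambda theorem this determines mu uniquely. *)
Definition is_product_measure (R : realType)
    (mus : forall i, probability (T i) R) (mu : probability product_space R) :=
  forall A : forall i, set (T i), (forall i, measurable (A i)) ->
    mu (box A) = (\prod_(i < s) mus i (A i))%E.

End Products.

Section Norms.
Context (R : realType) (k : scalar_kind).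

Definition lp_norm d (T : measurableType d) (mu : probability T R) (p : R)
    (f : T -> scalar_field R k) : \bar R :=
  Lnorm mu p%:E (fun x => (modulus (f x))%:E).

Definition uniform_norm (T : Type) (f : T -> scalar_field R k) : \bar R :=
  ereal_sup (range (fun x => (modulus (f x))%:E)).

End Norms.

Section Subspaces.
Context (K : numFieldType).

Definition span_of (T : Type) (S : set (T -> K)) : set (T -> K) :=
  [set f | exists n (c : 'I_n -> K) (g : 'I_n -> T -> K),
     (forall l, S (g l)) /\ f = fun x => \sum_(l < n) c l * g l x].

Definition lin_indep (T : Type) n (e : 'I_n -> T -> K) :=
  forall c : 'I_n -> K,
    (forall x, \sum_(l < n) c l * e l x = 0) -> forall l, c l = 0.

Definition subspace_of_dim (T : Type) (n : nat) (X : set (T -> K)) :=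
  exists2 e : 'I_n -> T -> K, lin_indep e & X = span_of (range e).

Definition tensor_space (s : nat) (T : 'I_s -> Type)
    (X : forall i, set (T i -> K)) : set ((forall i, T i) -> K) :=
  span_of [set f | exists g : forall i, T i -> K,
    (forall i, X i (g i)) /\ f = fun x => \prod_(i < s) g i (x i)].

End Subspaces.

Definition log2 (R : realType) (x : R) : R := ln x / ln 2.

(* The point family xi(m_1,1) x ... x xi(m_s,s), with repetitions, indexed by
   {0..m_1-1} x ... x {0..m_s-1}. *)
Definition tensor_points (s : nat) (T : 'I_s -> Type) (m : 'I_s -> nat)
    (xi : forall i, 'I_(m i) -> T i)
    (j : {dffun forall i : 'I_s, 'I_(m i)}) : forall i, T i :=
  fun i => xi i (j i).

(* Main.v *)
Require Import Defs.
From HB Require Import structures.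
From mathcomp Require Import all_boot all_order all_algebra.
From mathcomp Require Import all_classical all_reals all_analysis.
From mathcomp.real_closed Require Import complex.
From mathcomp Require Import measurable_realfun ring lra.
Set Implicit Arguments.
Unset Strict Implicit.
Unset Printing Implicit Defensive.
Import Order.TTheory GRing.Theory Num.Theory.
Import numFieldNormedType.Exports.

Local Open Scope classical_set_scope.
Local Open Scope ring_scope.

(** Write [M = B^p N^(p/q)] for one factor. The norms of a probability space
    increase with the exponent, so the assumption gives
    [|f(x)|^p <= M \int |f|^p] on the factor, and [M >= N]. These two facts
    suffice to find [m <= C M (1 + ln M)^3] points of the factor whose mean of
    [|f|^p] is within a factor [3/4], [4/3] of the integral, for all [f] of the
    space at once ([factor_discretization]).

    Integrals are replaced by finite sums from the beginning. The functions of
    the space oscillate little, relative to their size, on the cells of a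
    suitable finite measurable partition ([uniform_cells]), so it is enough to
    discretize a finitely supported probability measure. Points are then drawn
    independently. To control all functions simultaneously, [|f|^p] is written
    as a sum over geometrically growing levels [u] of [u^p] times the indicator
    of [|f| >= u], up to a constant factor close to one. To recognize this
    indicator it is enough to know [f] up to a small multiple of [u] in the
    uniform norm; there are [n = O(1 + ln M)] levels, and the indicator has
    probability at most [u^-p] when [\int |f|^p = 1]. If the unit ball has a net
    of [exp (D / u^p)] elements at resolution [u], then a union bound and
    Chernoff's inequality show that [O(n^2 (D + n M))] points suffice
    ([discretize_by_nets]). Variations of [f] on finer scales than [u] at level
    [u] change [|f|^p] by a small proportion of itself, and these errors add up
    to a small proportion of the whole.

    The net comes from the uniform convexity of the [p]-norm
    ([uniform_convexity_net]). Keep the convex set of functions compatible with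
    the values recorded so far, and take its element of nearly minimal norm. If
    this element is not within [u] of the unknown [f], record the value of [f],
    rounded, at a point where they differ by more than [u]. By Clarkson's
    inequality the minimal [p]-th power of the norm then grows by a constant
    multiple of [u^p / M], hence at most [O(M / u^p)] values are recorded, and
    [D = O(M ln (M #points))]. The number of points is made polynomial in [M] by a
    preliminary sample, for which a cruder net suffices: round the values at [N]
    interpolation points that maximize a determinant ([coordinate_net]). This
    gives [D = O(M (1 + ln M))] and [n^2 D = O(M (1 + ln M)^3)].

    For the tensor product, every section of [f] in the [i]-th variable belongs to
    the [i]-th space. In the finite sums that approximate the integral over the
    product one can therefore exchange the weights of the cells for those of the
    points in one variable after another, each time at the cost of a factor
    between [1/2] and [3/2] ([hybrid_le], [grid_mean_cell_mean]); finally the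
    cells are refined ([tensor_discretization]). *)

(** * Real and complex scalars *)

Section Modulus.
Context (R : realType) (k : scalar_kind).
Local Notation F := (scalar_field R k).
Local Notation nm := (@modulus R k).

Lemma modulus_ge0 (z : F) : 0 <= nm z.
Proof. by case: k z => [z|[a b]] /=; [exact: normr_ge0|exact: sqrtr_ge0]. Qed.

Lemma modulus0 : nm 0 = 0.
Proof. by case: k => /=; [rewrite normr0|exact: Normc.normc0]. Qed.

Lemma modulus1 : nm 1 = 1.
Proof. by case: k => /=; [rewrite normr1|exact: Normc.normc1]. Qed.

Lemma modulusM (a b : F) : nm (a * b) = nm a * nm b.
Proof. by case: k a b => a b /=; [rewrite normrM|exact: Normc.normcM]. Qed.

Lemma modulusD (a b : F) : nm (a + b) <= nm a + nm b.
Proof. by case: k a b => a b /=; [exact: ler_normD|exact: le_normcD]. Qed.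

Lemma modulusN (a : F) : nm (- a) = nm a.
Proof. by case: k a => a /=; [exact: normrN|exact: normcN]. Qed.

Lemma modulusBC (a b : F) : nm (a - b) = nm (b - a).
Proof. by rewrite -modulusN opprB. Qed.

Lemma modulus_eq0 (a : F) : nm a = 0 -> a = 0.
Proof. by case: k a => a /=; [move/normr0P/eqP|exact: Normc.eq0_normc]. Qed.

Lemma modulusB_lip (a b : F) : `|nm a - nm b| <= nm (a - b).
Proof.
rewrite ler_norml; apply/andP; split.
  rewrite lerBrDl lerBlDr modulusBC addrC.
  by apply: le_trans (modulusD _ _); rewrite subrK.
by rewrite lerBlDr; apply: le_trans (modulusD _ _); rewrite subrK.
Qed.

Lemma modulusV (a : F) : nm a^-1 = (nm a)^-1.
Proof.
have [->|a0] := eqVneq a 0; first by rewrite invr0 modulus0 invr0.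
have n0 : nm a != 0 by apply: contra_neq a0 => /modulus_eq0.
by apply: (mulIf n0); rewrite -modulusM mulVf // mulVf // modulus1.
Qed.

Lemma modulus_parallelogram (a b : F) :
  nm (a + b) ^+ 2 + nm (a - b) ^+ 2 = 2 * (nm a ^+ 2 + nm b ^+ 2).
Proof.
case: k a b => [a b|[a1 a2] [b1 b2]] /=; first by rewrite !real_normK ?num_real //; ring.
by rewrite !sqr_sqrtr ?addr_ge0 ?sqr_ge0 //; ring.
Qed.

Definition of_real : R -> F :=
  match k as k0 return R -> scalar_field R k0 with
  | RealScalars => fun r => r
  | ComplexScalars => fun r => (r%:C)%C
  end.

Lemma modulus_of_real (r : R) : nm (of_real r) = `|r|.
Proof.
rewrite /of_real; case: k => //=.
by rewrite expr0n /= addr0 sqrtr_sqr.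
Qed.

Lemma norm_lt_of_real (z : F) (e : R) : (`|z| < of_real e) = (nm z < e).
Proof. by rewrite /of_real; case: k z => [//|[a b]] /=; rewrite ltcR. Qed.

Lemma of_real_gt0 (e : R) : 0 < e -> 0 < of_real e.
Proof. by rewrite /of_real; case: k => //= e0; rewrite ltcR. Qed.

Lemma modulus_half (a : F) : nm (2^-1 * a) = 2^-1 * nm a.
Proof.
rewrite modulusM modulusV; congr (_^-1 * _).
rewrite (_ : 2 = of_real 2); first by rewrite modulus_of_real ger0_norm.
by rewrite /of_real; case: k => //=; rewrite rmorphMn.
Qed.

Lemma modulus_sum (I : Type) (r : seq I) (P : pred I) (f : I -> F) :
  nm (\sum_(i <- r | P i) f i) <= \sum_(i <- r | P i) nm (f i).
Proof.
elim/big_rec2: _ => [|i x y _ le]; first by rewrite modulus0.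
by apply: le_trans (modulusD _ _) _; rewrite lerD2l.
Qed.

(** Equally spaced points cover an interval, and a square grid covers a disc. *)
Lemma disc_grid (S d : R) : 0 < d -> d <= S ->
  exists2 g : seq F, (size g)%:R <= 36 * (S / d) ^+ 2 &
    forall z, nm z <= S -> exists2 v, v \in g & nm (z - v) <= d.
Proof.
move=> d0 dS.
have S0 : 0 < S by exact: lt_le_trans dS.
have line (e : R) : 0 < e -> e <= S -> exists2 g : seq R,
    (size g)%:R <= 3 * (S / e) &
    forall z, `|z| <= S -> exists2 v, v \in g & `|z - v| <= e.
  move=> e0 eS; have Se1 : 1 <= S / e by rewrite ler_pdivlMr // mul1r.
  set n := (Num.truncn (2 * S / e)).+1.
  exists [seq - S + j%:R * e | j <- iota 0 n].
    rewrite size_map size_iota /n -natr1.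
    have : (Num.truncn (2 * S / e))%:R <= 2 * S / e.
      have : 0 <= 2 * S / e by apply: divr_ge0; [lra|exact: ltW].
      by move=> /truncn_itv/andP[].
    by move: Se1; lra.
  move=> z; rewrite ler_norml => /andP[zl zu].
  have q0 : 0 <= (z + S) / e by apply: divr_ge0; [lra|exact: ltW].
  have /andP[jl ju] := truncn_itv q0; set j := Num.truncn _ in jl ju.
  exists (- S + j%:R * e).
    apply/mapP; exists j => //; rewrite mem_iota add0n /n ltnS.
    apply: le_truncn; rewrite ler_pM2r ?invr_gt0 //; lra.
  move: jl ju; rewrite ler_pdivlMr // ltr_pdivrMr // -natr1 mulrDl mul1r => jl ju.
  rewrite ler_norml; apply/andP; split; lra.
case: k => /=.
  have [g gs gP] := line d d0 dS; exists g => //.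
  apply: le_trans gs _.
  have : 1 <= S / d by rewrite ler_pdivlMr // mul1r.
  by set x := S / d; nra.
have h0 : 0 < d / 2 by exact: divr_gt0.
have hS : d / 2 <= S by apply: le_trans dS; lra.
have [g gs gP] := line (d / 2) h0 hS.
exists [seq (a +i* b)%C | a <- g, b <- g].
  rewrite size_allpairs natrM.
  have -> : 36 * (S / d) ^+ 2 = (3 * (S / (d / 2))) * (3 * (S / (d / 2))).
    by field; rewrite gt_eqF.
  by apply: ler_pM.
move=> [a b] /= ab.
have la : `|a| <= S.
  by apply: le_trans ab; rewrite -[leLHS]sqrtr_sqr ler_wsqrtr // lerDl sqr_ge0.
have lb : `|b| <= S.
  by apply: le_trans ab; rewrite -[leLHS]sqrtr_sqr ler_wsqrtr // lerDr sqr_ge0.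
have [u ug ua] := gP a la; have [v vg vb] := gP b lb.
exists (u +i* v)%C; first by apply/allpairsP; exists (u, v).
rewrite /= -[leRHS]ger0_norm; last exact: ltW.
rewrite -[leRHS]sqrtr_sqr ler_wsqrtr //.
rewrite -[(a - u) ^+ 2]real_normK ?num_real // -[(b - v) ^+ 2]real_normK ?num_real //.
have := normr_ge0 (a - u); have := normr_ge0 (b - v).
move: ua vb; set x := `|a - u|; set y := `|b - v|; nra.
Qed.

End Modulus.

(** * Sampling from a finite probability space *)

Lemma expR_le_quadratic (R : realType) (s : R) :
  s <= 1 / 2 -> expR s <= 1 + s + 2 * s ^+ 2.
Proof.
move=> s2; have s1 : 0 < 1 - s by lra.
have : 1 - s <= expR (- s) by apply: expR_ge1Dx.
rewrite expRN -[leLHS]invrK lef_pV2 ?posrE ?invr_gt0 ?expR_gt0 // => h.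
apply: le_trans h _; rewrite -[leLHS]mul1r ler_pdivrMr //; nra.
Qed.

Section Sampling.
Context (R : realType) (I : finType) (w : I -> R).
Hypothesis w_ge0 : forall i, 0 <= w i.
Hypothesis w_sum : \sum_i w i = 1.

Local Notation weight z := (\prod_j w (z j)).

Lemma sum_weight m (phi : I -> R) :
  \sum_(z : {ffun 'I_m -> I}) weight z * \prod_j phi (z j) =
  (\sum_i w i * phi i) ^+ m.
Proof.
rewrite -[in RHS](card_ord m) -prodr_const bigA_distr_bigA /=.
by apply: eq_bigr => z _; rewrite big_split.
Qed.

Lemma bernoulli_mgf m (b : I -> bool) (s y : R) :
  s <= 1 / 2 -> y = \sum_i w i * (b i)%:R ->
  \sum_(z : {ffun 'I_m -> I}) weight z * expR (s * \sum_j (b (z j))%:R) <=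
  expR (m%:R * (y * (s + 2 * s ^+ 2))).
Proof.
move=> s2 yE.
under eq_bigr do rewrite mulr_sumr expR_sum.
rewrite (sum_weight m (fun i => expR (s * (b i)%:R))) expRM_natl.
have y0 : 0 <= y by rewrite yE; apply: sumr_ge0 => i _; rewrite mulr_ge0.
apply: lerXn2r; rewrite ?nnegrE ?expR_ge0 //.
  by apply: sumr_ge0 => i _; rewrite mulr_ge0 ?expR_ge0.
apply: le_trans (expR_ge1Dx _).
have -> : \sum_i w i * expR (s * (b i)%:R) = 1 + y * (expR s - 1).
  rewrite yE mulr_suml -[X in X + _]w_sum -big_split /=; apply: eq_bigr => i _.
  by case: (b i); rewrite /= ?mulr1n ?mulr0n ?mulr1 ?mulr0 ?expR0; ring.
rewrite lerD2l; apply: ler_wpM2l => //.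
by rewrite lerBlDl addrA; exact: expR_le_quadratic.
Qed.

(** A union bound over exponential moments (Chernoff): for events of
    probability at most [1 / U], the frequency in an independent sample of size
    [m] misses the probability by more than [1 / (n U)] with probability at most
    [2 exp (- m / (8 n ^ 2 U))]. *)
Lemma sample_frequencies (m n : nat) (T : eqType) (L : seq T)
    (b : T -> I -> bool) (U : T -> R) :
  (0 < n)%N ->
  (forall x, x \in L -> 0 < U x) ->
  (forall x, x \in L -> \sum_i w i * (b x i)%:R <= (U x)^-1) ->
  \sum_(x <- L) 2 * expR (- (m%:R / (8 * n%:R ^+ 2 * U x))) < 1 ->
  exists z : 'I_m -> I, forall x, x \in L ->
    `|\sum_j (b x (z j))%:R - m%:R * \sum_i w i * (b x i)%:R| <=
    m%:R / (n%:R * U x).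
Proof.
move=> n0 U0 bU small.
have n0' : (0 : R) < n%:R by rewrite ltr0n.
have n1' : (1 : R) <= n%:R by rewrite ler1n.
(* The minimizer of the exponent [2 m s^2 / U - s m / (n U)]. *)
pose s : R := 1 / (4 * n%:R).
have s0 : 0 < s by rewrite divr_gt0 // mulr_gt0.
have s4 : s <= 1 / 4.
  by rewrite /s ler_pdivrMr ?mulr_gt0 // ; lra.
pose y x := \sum_i w i * (b x i)%:R.
pose S x (z : {ffun 'I_m -> I}) : R := \sum_j (b x (z j))%:R.
pose e x := m%:R / (n%:R * U x).
pose term x z :=
  expR (s * S x z) * expR (- (s * (m%:R * y x + e x))) +
  expR (- s * S x z) * expR (s * (m%:R * y x - e x)).
have termE x z : term x z = expR (s * (S x z - m%:R * y x - e x)) +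
    expR (s * (- (S x z - m%:R * y x) - e x)).
  by rewrite /term -!expRD; congr (expR _ + expR _); ring.
have total : \sum_(z : {ffun 'I_m -> I}) weight z * \sum_(x <- L) term x z < 1.
  under eq_bigr do rewrite mulr_sumr.
  rewrite exchange_big /=; apply: le_lt_trans small.
  rewrite big_seq_cond [leRHS]big_seq_cond; apply: ler_sum => x /andP[xL _].
  rewrite /term.
  under eq_bigr do rewrite mulrDr !mulrA.
  rewrite big_split /= -!mulr_suml.
  have y0 : 0 <= y x by apply: sumr_ge0 => i _; rewrite mulr_ge0.
  have key : 2 * m%:R * y x * s ^+ 2 - s * e x <=
      - (m%:R / (8 * n%:R ^+ 2 * U x)).
    have -> : - (m%:R / (8 * n%:R ^+ 2 * U x)) =
        2 * m%:R * (U x)^-1 * s ^+ 2 - s * e x.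
      by rewrite /s /e; field; rewrite !gt_eqF ?U0.
    rewrite lerD2r; apply: ler_wpM2r; first exact: sqr_ge0.
    by apply: ler_wpM2l; [rewrite mulr_ge0|exact: bU].
  rewrite [leRHS]mulr_natl [leRHS]mulr2n; apply: lerD.
    apply: le_trans (ler_wpM2r (expR_ge0 _) (bernoulli_mgf _ _ (erefl (y x)))) _.
      lra.
    rewrite -expRD ler_expR; apply: le_trans key.
    by rewrite le_eqVlt; apply/orP; left; apply/eqP; ring.
  apply: le_trans (ler_wpM2r (expR_ge0 _) (bernoulli_mgf _ _ (erefl (y x)))) _.
    lra.
  rewrite -expRD ler_expR; apply: le_trans key.
  by rewrite le_eqVlt; apply/orP; left; apply/eqP; ring.
have [z zsmall] : exists z : {ffun 'I_m -> I}, \sum_(x <- L) term x z < 1.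
  apply: contrapT => /forallNP none.
  move: total; apply/negP; rewrite -leNgt.
  have total_weight : \sum_(z : {ffun 'I_m -> I}) weight z * 1 = 1.
    have := sum_weight m (fun=> 1).
    have -> : \sum_i w i * 1 = 1.
      by rewrite -[RHS]w_sum; apply: eq_bigr => i _; rewrite mulr1.
    rewrite expr1n => total1; rewrite -[RHS]total1; apply: eq_bigr => z _.
    by congr (_ * _); rewrite big1.
  rewrite -[leLHS]total_weight; apply: ler_sum => z _; apply: ler_wpM2l; first exact: prodr_ge0.
  by rewrite leNgt; apply/negP/none.
exists z => x xL.
have term_ge0 x' : 0 <= term x' z by rewrite termE addr_ge0 ?expR_ge0.
have : term x z < 1.
  apply: le_lt_trans zsmall; rewrite (big_rem x) //= lerDl.
  by apply: sumr_ge0.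
rewrite termE -/(S x z) -/(y x) -/(e x) => lt1.
have neg t : expR (s * t) < 1 -> t < 0 by rewrite expR_lt1 pmulr_rlt0.
rewrite ler_norml; apply/andP; split.
  have /neg : expR (s * (- (S x z - m%:R * y x) - e x)) < 1.
    by apply: le_lt_trans lt1; rewrite lerDr expR_ge0.
  by lra.
have /neg : expR (s * (S x z - m%:R * y x - e x)) < 1.
  by apply: le_lt_trans lt1; rewrite lerDl expR_ge0.
by lra.
Qed.

End Sampling.

Section Levels.
Context (R : realType).

(** The [p]-th powers of the levels: they start at a negligible value and grow by
    the factor [101 / 100], the precision to which [|f|^p] is resolved. *)
Definition level (r : nat) : R := (1 + 1 / 100) ^+ r / 100.

Lemma level_gt0 r : 0 < level r.
Proof. by rewrite divr_gt0 // exprn_gt0 //; lra. Qed.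

Lemma levelS r : level r.+1 = (1 + 1 / 100) * level r.
Proof. by rewrite /level exprS mulrA. Qed.

Lemma level_le r r' : (r <= r')%N -> level r <= level r'.
Proof.
move=> rr; rewrite ler_pM2r ?invr_gt0 // ler_weXn2l //; lra.
Qed.

(** Summation by layers: only the comparison of [t] with a geometric sequence
    enters, and the indicator [b r] may be wrong when [t] lies between two
    consecutive levels. *)
Lemma layer_sum_le (b : nat -> bool) (t : R) n : 0 <= t ->
  (forall r, (r < n)%N -> b r -> level r <= t) ->
  \sum_(r < n) level r / 100 * (b r)%:R <= (1 + 1 / 100) * t.
Proof.
move=> t0; elim: n => [|n IH] bt; first by rewrite big_ord0 mulr_ge0 //; lra.
rewrite big_ord_recr /=; case: (boolP (b n)) => bn; last first.
  by rewrite mulr0 addr0; apply: IH => r rn; apply: bt; exact: ltnW.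
have le_n := bt n (leqnn _) bn; rewrite mulr1.
have : \sum_(r < n) level r / 100 * (b r)%:R <= level n - level 0.
  elim: {IH bt bn le_n} n => [|n IH]; first by rewrite big_ord0 subrr.
  rewrite big_ord_recr /= levelS; have := level_gt0 n.
  by case: (b n); rewrite ?mulr1 ?mulr0; move: IH; lra.
have := level_gt0 0; lra.
Qed.

Lemma layer_sum_ge (b : nat -> bool) (t : R) n : t < level n ->
  (forall r, (r < n)%N -> level r.+1 <= t -> b r) ->
  t <= (1 + 1 / 100) * (\sum_(r < n) level r / 100 * (b r)%:R + 1 / 100).
Proof.
elim: n => [|n IH] tn bt.
  by rewrite big_ord0; move: tn; rewrite /level expr0; lra.
have [{}tn|nt] := ltP t (level n).
  rewrite big_ord_recr /=.
  have := IH tn (fun r rn => bt r (ltnW rn)).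
  have : 0 <= level n / 100 * (b n)%:R.
    by rewrite mulr_ge0 // divr_ge0 // ltW // level_gt0.
  lra.
have : level n - level 0 <= \sum_(r < n.+1) level r / 100 * (b r)%:R.
  rewrite big_ord_recr /= -[leLHS]addr0; apply: lerD; last first.
    by rewrite mulr_ge0 // divr_ge0 // ltW // level_gt0.
  have : forall r, (r < n)%N -> b r.
    move=> r rn; apply: bt; first exact: ltnW.
    by apply: le_trans nt; exact: level_le.
  elim: {IH tn bt nt} n => [|n IH] ball; first by rewrite big_ord0 subrr.
  rewrite big_ord_recr /= ball // mulr1 levelS.
  have := IH (fun r rn => ball r (ltnW rn)); lra.
by move: tn; rewrite levelS {3}/level expr0; lra.
Qed.

End Levels.

Definition covers (R : realType) (I : Type) (A : set (I -> R)) (d : R)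
    (G : seq (I -> R)) :=
  forall a, A a -> exists2 l, (l < size G)%N &
    forall i, `|a i - nth (fun=> 0) G l i| <= d.

(** Half the distance of two consecutive levels: at this resolution a comparison
    with their midpoint tells [a >= u] for the larger level from [a < u] for the
    smaller one. *)
Definition level_gap (R : realType) (p : R) (r : nat) : R :=
  (level R r.+1 `^ p^-1 - level R r `^ p^-1) / 2.

Section DiscretizeByNets.
Context (R : realType) (I : finType) (w : I -> R) (p M D : R) (n m : nat).
Context (A : set (I -> R)) (G : nat -> seq (I -> R)).
Hypothesis w_ge0 : forall i, 0 <= w i.
Hypothesis w_sum : \sum_i w i = 1.
Hypothesis p_gt0 : 0 < p.
Hypothesis n_gt0 : (0 < n)%N.
Hypothesis level_leM : forall r, (r < n)%N -> level R r <= M.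
Hypothesis level_gtM : M < level R n.
Hypothesis A_ge0 : forall a i, A a -> 0 <= a i.
Hypothesis A_leM : forall a i, A a -> a i `^ p <= M.
Hypothesis A_norm : forall a, A a -> \sum_i w i * a i `^ p = 1.
Hypothesis G_covers : forall r, (r < n)%N -> covers A (level_gap p r) (G r).
Hypothesis G_size : forall r, (r < n)%N -> (size (G r))%:R <= expR (D / level R r).
Hypothesis m_large : 8 * n%:R ^+ 2 * (D + 2 * n%:R * M) <= m%:R.

Let mid r : R := (level R r `^ p^-1 + level R r.+1 `^ p^-1) / 2.
Let above (x : nat * nat) (i : I) : bool :=
  mid x.1 <= nth (fun=> 0) (G x.1) x.2 i.

Let prob x := \sum_i w i * (above x i)%:R.

Let candidates := [seq x <- [seq (r, l) | r <- iota 0 n, l <- iota 0 (size (G r))]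
                  | prob x <= (level R x.1)^-1].

Let mem_candidates x : x \in candidates =
  [&& prob x <= (level R x.1)^-1, (x.1 < n)%N & (x.2 < size (G x.1))%N].
Proof.
rewrite mem_filter; congr andb; apply/allpairsPdep/andP.
  by move=> [r [l []]]; rewrite !mem_iota !add0n => rn ln ->.
by move=> [rn ln]; exists x.1, x.2; rewrite !mem_iota !add0n; split => //; case: (x).
Qed.

Let candidates_sum :
  \sum_(x <- candidates) 2 * expR (- (m%:R / (8 * n%:R ^+ 2 * level R x.1))) < 1.
Proof.
have n0' : (0 : R) < n%:R by rewrite ltr0n.
rewrite big_filter; apply: (@le_lt_trans _ _ (n%:R * (2 * expR (- (2 * n%:R))))).
  apply: (@le_trans _ _ (\sum_(x <- [seq (r, l) | r <- iota 0 n, l <- iota 0 (size (G r))])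
     2 * expR (- (m%:R / (8 * n%:R ^+ 2 * level R x.1))))).
    rewrite big_mkcond /=; apply: ler_sum => x _.
    by case: ifP => // _; rewrite mulr_ge0 // expR_ge0.
  rewrite big_allpairs_dep /=.
  apply: (@le_trans _ _ (\sum_(r <- iota 0 n) 2 * expR (- (2 * n%:R)))); last first.
    by rewrite big_const_seq count_predT size_iota iter_addr_0 [leRHS]mulr_natl.
  rewrite big_seq_cond [leRHS]big_seq_cond; apply: ler_sum => r /andP[].
  rewrite mem_iota add0n => /= rn _.
  rewrite big_const_seq count_predT size_iota iter_addr_0 -[leLHS]mulr_natl mulrCA.
  apply: ler_wpM2l => //.
  have L0 := level_gt0 R r; have LM := level_leM rn.
  apply: le_trans (ler_wpM2r (expR_ge0 _) (G_size rn)) _.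
  rewrite -expRD ler_expR.
  have -> : m%:R / (8 * n%:R ^+ 2 * level R r) =
      m%:R / (8 * n%:R ^+ 2) / level R r.
    by field; rewrite !gt_eqF.
  rewrite -mulrBl ler_pdivrMr //.
  have : D + 2 * n%:R * M <= m%:R / (8 * n%:R ^+ 2).
    by rewrite ler_pdivlMr ?mulr_gt0 ?exprn_gt0 // mulrC.
  have : n%:R * level R r <= n%:R * M by rewrite ler_pM2l.
  by rewrite mulNr -mulrA; lra.
rewrite expRN mulrA ltr_pdivrMr ?expR_gt0 // mul1r.
apply: lt_le_trans (expR_ge1Dx _).
by rewrite mulrC; lra.
Qed.

(** Write [a ^ p] as a sum over geometrically growing levels [u ^ p] of
    [u ^ p] times the indicator of [a >= u]. At level [u] the function [a] only
    matters up to a small multiple of [u], so the net at that resolution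
    suffices: its elements give at most [exp (D / u ^ p)] events, of probability
    at most [u ^ - p] by Markov's inequality. Each of the [n] levels may
    contribute an error of order [1 / n], which by Chernoff's bound takes
    [m ~ n ^ 2 D] points at every level alike. *)
Lemma discretize_by_nets : exists z : 'I_m -> I, forall a, A a ->
  9 / 10 * m%:R <= \sum_j a (z j) `^ p <= 11 / 10 * m%:R.
Proof.
have n0' : (0 : R) < n%:R by rewrite ltr0n.
have [||z zP] := @sample_frequencies R I w w_ge0 w_sum m n _ candidates above
  (fun x => level R x.1) n_gt0 _ _ candidates_sum.
- by move=> x _; exact: level_gt0.
- by move=> x; rewrite mem_candidates => /and3P[].
exists z => a Aa.
have V0 : 0 <= p^-1 by rewrite invr_ge0 ltW.
have rootK r : (level R r `^ p^-1) `^ p = level R r.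
  by rewrite -powRrM mulVf ?gt_eqF // powRr1 // ltW // level_gt0.
have root_le r i : level R r <= a i `^ p -> level R r `^ p^-1 <= a i.
  move=> h; rewrite -[leRHS](@powRr1 _ (a i)) ?A_ge0 //.
  rewrite -(@mulfV _ p) ?gt_eqF // powRrM.
  by apply: ge0_ler_powR; rewrite ?nnegrE ?powR_ge0 // ltW // level_gt0.
have le_root r i : level R r `^ p^-1 <= a i -> level R r <= a i `^ p.
  move=> h; rewrite -(rootK r).
  by apply: ge0_ler_powR; rewrite ?nnegrE ?powR_ge0 ?(ltW p_gt0) //; exact: A_ge0.
have cov r : exists l, (r < n)%N -> (l < size (G r))%N /\
    forall i, `|a i - nth (fun=> 0) (G r) l i| <= level_gap p r.
  case: (ltnP r n) => rn; last by exists 0%N.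
  by have [l ls lP] := G_covers rn Aa; exists l.
have [l lP] := choice cov.
pose b i r := above (r, l r) i.
have b_le i r : (r < n)%N -> b i r -> level R r <= a i `^ p.
  move=> /lP[_ /(_ i)]; rewrite ler_norml /b /above /mid /level_gap /= => /andP[d1 d2] d3.
  by apply: le_root; move: d1 d2 d3; set X := nth _ _ _ _; lra.
have b_ge i r : (r < n)%N -> level R r.+1 <= a i `^ p -> b i r.
  move=> /lP[_ /(_ i)] + /root_le; rewrite ler_norml /b /above /mid /level_gap /= => /andP[d1 d2] d3.
  by move: d1 d2 d3; set X := nth _ _ _ _; lra.
have cand r : (r < n)%N -> (r, l r) \in candidates.
  move=> rn; rewrite mem_candidates /= rn (proj1 (lP r rn)) !andbT.
  have L0 := level_gt0 R r.
  rewrite -[leRHS]mul1r ler_pdivlMr // -(A_norm Aa) mulr_suml.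
  apply: ler_sum => i _; rewrite -mulrA; apply: ler_wpM2l => //.
  case: (boolP (above (r, l r) i)) => [ab|_]; first by rewrite mul1r b_le.
  by rewrite mul0r powR_ge0.
pose s i := \sum_(r < n) level R r / 100 * (b i r)%:R.
have s_le i : s i <= (1 + 1 / 100) * a i `^ p.
  by apply: layer_sum_le => [|r rn]; [exact: powR_ge0|exact: b_le].
have s_ge i : a i `^ p <= (1 + 1 / 100) * (s i + 1 / 100).
  apply: layer_sum_ge => [|r rn]; last exact: b_ge.
  by apply: le_lt_trans level_gtM; exact: A_leM.
pose Es := \sum_i w i * s i.
have Es_le : Es <= 1 + 1 / 100.
  have : Es <= (1 + 1 / 100) * \sum_i w i * a i `^ p.
    by rewrite mulr_sumr; apply: ler_sum => i _; rewrite mulrCA; apply: ler_wpM2l.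
  by rewrite A_norm // mulr1.
have Es_ge : 1 <= (1 + 1 / 100) * (Es + 1 / 100).
  have : \sum_i w i * a i `^ p <=
      (1 + 1 / 100) * (Es + (\sum_i w i) / 100).
    rewrite mulr_suml -big_split mulr_sumr; apply: ler_sum => i _ /=.
    by rewrite -mulrDr mulrCA; apply: ler_wpM2l => //; have := s_ge i; rewrite !div1r.
  by rewrite A_norm // w_sum.
(* Each of the [n] levels contributes at most [m / (100 n)]. *)
have dev : `|\sum_j s (z j) - m%:R * Es| <= m%:R / 100.
  have -> : \sum_j s (z j) - m%:R * Es = \sum_(r < n) level R r / 100 *
      (\sum_j (b (z j) r)%:R - m%:R * prob ((r : nat), l r)).
    have -> : Es = \sum_(r < n) level R r / 100 * prob ((r : nat), l r).
      rewrite /Es; under eq_bigr do rewrite mulr_sumr.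
      rewrite exchange_big; apply: eq_bigr => r _.
      by rewrite mulr_sumr; apply: eq_bigr => i _; rewrite mulrCA.
    rewrite /s exchange_big mulr_sumr -sumrB; apply: eq_bigr => r _.
    by rewrite mulrBr [in RHS]mulr_sumr; congr (_ - _); rewrite mulrCA.
  apply: le_trans (ler_norm_sum _ _ _) _.
  have -> : m%:R / 100 = \sum_(r < n) (m%:R / (100 * n%:R) : R).
    by rewrite sumr_const card_ord -mulr_natl; field; rewrite gt_eqF.
  apply: ler_sum => r _; have L0 := level_gt0 R r.
  rewrite normrM ger0_norm; last by rewrite divr_ge0 // ltW.
  apply: le_trans (ler_wpM2l _ (zP _ (cand r (ltn_ord r)))) _.
    by rewrite divr_ge0 // ltW.
  by rewrite le_eqVlt; apply/orP; left; apply/eqP; field; rewrite !gt_eqF.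
have m0 : 0 <= m%:R :> R by [].
have up : \sum_j a (z j) `^ p <= (1 + 1 / 100) * (\sum_j s (z j) + m%:R / 100).
  have -> : m%:R / 100 = \sum_(j < m) (1 / 100 : R).
    by rewrite sumr_const card_ord -mulr_natl; ring.
  by rewrite -big_split mulr_sumr /=; apply: ler_sum => j _; exact: s_ge.
have lo : \sum_j s (z j) <= (1 + 1 / 100) * \sum_j a (z j) `^ p.
  by rewrite mulr_sumr; apply: ler_sum => j _; exact: s_le.
move: dev; rewrite ler_norml => /andP[dev1 dev2].
set X := \sum_j s (z j) in up lo dev1 dev2; set Y := \sum_j _ in up lo *.
have h1 : m%:R * Es <= m%:R * (1 + 1 / 100) by rewrite ler_wpM2l.
have h2 : m%:R <= (1 + 1 / 100) * (m%:R * Es + m%:R / 100).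
  have := ler_wpM2l m0 Es_ge; rewrite mulr1 => h; apply: le_trans h _.
  by rewrite le_eqVlt; apply/orP; left; apply/eqP; ring.
set Z := m%:R * Es in h1 h2 dev1 dev2.
apply/andP; split; lra.
Qed.

End DiscretizeByNets.

(** * Nets from uniform convexity *)

Section Clarkson.
Context (R : realType) (k : scalar_kind).
Local Notation F := (scalar_field R k).
Local Notation nm := (@modulus R k).

Lemma powR_superadd (r a b : R) : 1 <= r -> 0 <= a -> 0 <= b ->
  a `^ r + b `^ r <= (a + b) `^ r.
Proof.
move=> r1 a0 b0.
have [ab|ab] := eqVneq (a + b) 0.
  have -> : a = 0 by lra.
  have -> : b = 0 by lra.
  by rewrite addr0 powR0 ?addr0 // gt_eqF; lra.
have ab0 : 0 < a + b by rewrite lt0r ab addr_ge0.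
have part x : 0 <= x -> x <= a + b -> x `^ r <= x / (a + b) * (a + b) `^ r.
  move=> x0 xab.
  have -> : x `^ r = (x / (a + b)) `^ r * (a + b) `^ r.
    by rewrite -powRM ?divr_ge0 // ?divfK // ltW.
  apply: ler_wpM2r; first exact: powR_ge0.
  have q0 : 0 <= x / (a + b) by rewrite divr_ge0 // ltW.
  have q1 : x / (a + b) <= 1 by rewrite ler_pdivrMr // mul1r.
  have [q|q] := eqVneq (x / (a + b)) 0.
    by rewrite q powR0 // gt_eqF; lra.
  rewrite -[leRHS]powRr1 //; apply: ger_powR => //.
  by rewrite lt0r q q0.
have := lerD (part a a0 _) (part b b0 _); rewrite lerDl lerDr => /(_ b0 a0) h.
apply: le_trans h _; rewrite -mulrDl -mulrDl divff // mul1r //.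
Qed.

Lemma powR_midpoint (r a b : R) : 1 <= r -> 0 <= a -> 0 <= b ->
  ((a + b) / 2) `^ r <= (a `^ r + b `^ r) / 2.
Proof.
move=> r1 a0 b0.
have h : (0 <= 2^-1 :> R) && (2^-1 <= 1 :> R) by apply/andP; split; lra.
have := @convex_powR R r r1 (Itv01 (proj1 (andP h)) (proj2 (andP h))) a b.
rewrite !inE /= !in_itv /= !andbT => /(_ a0 b0).
rewrite convRE [X in X `^ _ <= _ -> _]convRE /= /unstable.onem.
have -> : (1 - 2^-1 : R) = 2^-1 by lra.
by rewrite -!mulrDr mulrC [X in _ <= X -> _]mulrC.
Qed.

(** The parallelogram law, raised to the power [p / 2]. *)
Lemma clarkson (p : R) (a b : F) : 2 <= p ->
  nm (2^-1 * (a + b)) `^ p + nm (2^-1 * (a - b)) `^ p <=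
  (nm a `^ p + nm b `^ p) / 2.
Proof.
move=> p2; have r1 : 1 <= p / 2 by lra.
have sq x : 0 <= x -> x `^ p = (x ^+ 2) `^ (p / 2).
  by move=> x0; rewrite -powR_mulrn // -powRrM mulrC divfK.
rewrite !(sq (nm _)) ?modulus_ge0 //.
apply: le_trans (powR_superadd r1 (sqr_ge0 _) (sqr_ge0 _)) _.
apply: le_trans (powR_midpoint r1 (sqr_ge0 _) (sqr_ge0 _)).
rewrite !modulus_half le_eqVlt; apply/orP; left; apply/eqP; congr (_ `^ _).
have := modulus_parallelogram a b; lra.
Qed.

End Clarkson.

Section VersionSpaces.
Context (R : realType) (k : scalar_kind) (I : finType).
Local Notation F := (scalar_field R k).
Local Notation nm := (@modulus R k).
Context (p M d : R) (Phi : (I -> F) -> R) (Y : set (I -> F)) (g : seq F).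
Local Notation mid f f' := (fun i => 2^-1 * (f i + f' i)).
Local Notation hdiff f f' := (fun i => 2^-1 * (f i - f' i)).
Hypothesis p_gt0 : 0 < p.
Hypothesis d_gt0 : 0 < d.
Hypothesis M_gt0 : 0 < M.
Hypothesis Phi_ge0 : forall f, 0 <= Phi f.
Hypothesis Phi_clarkson : forall f f',
  Phi (mid f f') + Phi (hdiff f f') <= (Phi f + Phi f') / 2.
Hypothesis Y_mid : forall f f', Y f -> Y f' -> Y (mid f f').
Hypothesis Y_hdiff : forall f f', Y f -> Y f' -> Y (hdiff f f').
Hypothesis Y_nikolskii : forall f i, Y f -> nm (f i) `^ p <= M * Phi f.
Hypothesis g_covers : forall f i, Y f -> Phi f <= 1 ->
  exists2 v, v \in g & nm (f i - v) <= d / 4.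

Let gain := (d / 4) `^ p / M.
Let mid_closed (V : set (I -> F)) := forall f f', V f -> V f' -> V (mid f f').

Let gain_gt0 : 0 < gain.
Proof. by rewrite divr_gt0 // powR_gt0 // divr_gt0. Qed.

(** A near-minimizer [c] of [Phi] on [V] either approximates [f] uniformly, or
    some value [f i] is far from [c i]. In the latter case all the elements of
    [V] with nearly that value at [i] are far from [c], and by uniform convexity
    this forces [Phi] to exceed its infimum on [V] by [gain]. *)
Let version_space_net n : forall V, V `<=` Y -> mid_closed V ->
  (forall f, V f -> 1 - n%:R * gain < Phi f) ->
  exists2 G : seq (I -> F), (size G <= (1 + #|I| * size g) ^ n)%N &
    forall f, V f -> Phi f <= 1 ->
      exists2 l, (l < size G)%N & forall i, nm (f i - nth (fun=> 0) G l i) <= d.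
Proof.
elim: n => [|n IH] V VY Vmid Vlow.
  exists [::] => // f Vf; have := Vlow f Vf; lra.
have [[f0 Vf0]|V0] := pselect (V !=set0); last first.
  by exists [::] => // f Vf; case: V0; exists f.
pose rho := inf (Phi @` V).
have lowb : has_lbound (Phi @` V) by exists 0 => _ [f _ <-].
have hasinf : has_inf (Phi @` V) by split => //; exists (Phi f0); exists f0.
have rho_le f : V f -> rho <= Phi f by move=> Vf; apply: ge_inf => //; exists f.
have [_ [c Vc <-] c_min] := inf_adherent gain_gt0 hasinf.
rewrite -/rho in c_min.
have rho_ge : 1 - n.+1%:R * gain <= rho.
  by apply: lb_le_inf; [exact: (proj1 hasinf)|move=> _ [f /Vlow/ltW ? <-]].
pose W (x : I * F) : set (I -> F) :=
  [set f | [/\ V f, nm (f x.1 - x.2) <= d / 4 & 3 * d / 4 < nm (x.2 - c x.1)]].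
have sub x : exists G : seq (I -> F), (size G <= (1 + #|I| * size g) ^ n)%N /\
    forall f, W x f -> Phi f <= 1 ->
      exists2 l, (l < size G)%N & forall i, nm (f i - nth (fun=> 0) G l i) <= d.
  have [|||G Gs GP] := IH (W x); last by exists G.
  - by move=> f [Vf _ _]; exact: VY.
  - move=> f f' [Vf fx cx] [Vf' fx' _]; split => //; first exact: Vmid.
    have -> : 2^-1 * (f x.1 + f' x.1) - x.2 =
        2^-1 * (f x.1 - x.2) + 2^-1 * (f' x.1 - x.2) by field.
    apply: le_trans (modulusD _ _) _; rewrite !modulus_half; lra.
  - move=> f [Vf fx cx].
    have far : d / 2 < nm (f x.1 - c x.1).
      have : nm (x.2 - c x.1) <= nm (x.2 - f x.1) + nm (f x.1 - c x.1).
        by apply: le_trans (modulusD _ _); rewrite addrA subrK.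
      rewrite (modulusBC x.2 (f x.1)); lra.
    have gain_le : gain <= Phi (hdiff f c).
      rewrite /gain ler_pdivrMr // [leRHS]mulrC.
      apply: le_trans (Y_nikolskii x.1 (Y_hdiff (VY _ Vf) (VY _ Vc))).
      rewrite modulus_half; apply: ge0_ler_powR.
      + exact: ltW.
      + by rewrite nnegrE divr_ge0 // ltW.
      + by rewrite nnegrE mulr_ge0 ?modulus_ge0.
      + lra.
    have := rho_le _ (Vmid _ _ Vf Vc); have := Phi_clarkson f c.
    move: rho_ge; rewrite -natr1 mulrDl mul1r; lra.
have [G GP] := choice sub.
pose xs := [seq (i, v) | i <- enum I, v <- g].
(* Either [c] itself, or one of the nets after recording one more value. *)
exists (c :: flatten [seq G x | x <- xs]).
  rewrite /= size_flatten /shape -map_comp expnS.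
  have le : (sumn [seq (size \o G) x | x <- xs] <= size xs * (1 + #|I| * size g) ^ n)%N.
    elim: xs => [//|x xs IHx] /=; rewrite mulSn; apply: leq_add => //.
    by have [] := GP x.
  have -> : (#|I| * size g)%N = size xs by rewrite size_allpairs cardE.
  rewrite mulnDl mul1n -addn1 addnC leq_add //.
    by rewrite expn_gt0.
  by apply: leq_trans le _; rewrite /xs size_allpairs -cardE.
move=> f Vf f1.
have [near|] := pselect (forall i, nm (f i - c i) <= d).
  by exists 0%N.
move=> /existsNP[i /negP]; rewrite -ltNge => far.
have [v vg fv] := g_covers i (VY _ Vf) f1.
have Wf : W (i, v) f.
  split => //=.
  have : nm (f i - c i) <= nm (f i - v) + nm (v - c i).
    by apply: le_trans (modulusD _ _); rewrite addrA subrK.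
  lra.
have [_ /(_ f Wf f1)[l ls lP]] := GP (i, v).
have xin : (i, v) \in xs by apply/allpairsP; exists (i, v); rewrite mem_enum.
have [l' l's l'E] : exists2 l', (l' < size (flatten [seq G x | x <- xs]))%N &
    nth (fun=> 0) (flatten [seq G x | x <- xs]) l' = nth (fun=> 0) (G (i, v)) l.
  elim: xs xin => [//|x xs IHx] /=; rewrite inE => /predU1P[<-|/IHx[l' l's l'E]].
    by exists l; [rewrite size_cat ltn_addr|rewrite nth_cat ls].
  exists (size (G x) + l')%N; first by rewrite size_cat ltn_add2l.
  by rewrite nth_cat ltnNge leq_addr /= addKn.
by exists l'.+1 => // i'; rewrite /= l'E.
Qed.

(** The infimum of [Phi] starts at [0] or above and gains [gain] with every
    recorded value, so the number of values is less than [n] before it exceeds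
    [1]; the net has one element for each list of recorded values. *)
Lemma uniform_convexity_net n : M * (4 / d) `^ p < n%:R ->
  exists2 G : seq (I -> F), (size G <= (1 + #|I| * size g) ^ n)%N &
    forall f, Y f -> Phi f <= 1 ->
      exists2 l, (l < size G)%N & forall i, nm (f i - nth (fun=> 0) G l i) <= d.
Proof.
move=> nlarge; apply: version_space_net => // f Yf.
apply: (lt_le_trans _ (Phi_ge0 f)); rewrite subr_lt0 -ltr_pdivrMr //.
apply: le_lt_trans nlarge; rewrite /gain invf_div mul1r.
have d4 : 0 <= d / 4 by rewrite divr_ge0 // ltW.
by rewrite -[4 / d]invf_div -(powR_inv1 d4) powRAC powR_inv1 ?powR_ge0.
Qed.

End VersionSpaces.

(** * Interpolation points and coordinate nets *)

Section Span.
Context (K : numFieldType) (T : Type) (S : set (T -> K)).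

Lemma span_ofZ (a : K) f : span_of S f -> span_of S (fun x => a * f x).
Proof.
move=> [n [c [g [gS ->]]]]; exists n, (fun l => a * c l), g; split => //.
by apply/funext => x; rewrite mulr_sumr; apply: eq_bigr => l _; rewrite mulrA.
Qed.

Lemma span_ofD f f' : span_of S f -> span_of S f' ->
  span_of S (fun x => f x + f' x).
Proof.
move=> [n [c [g [gS ->]]]] [n' [c' [g' [gS' ->]]]].
pose pick (A : Type) (u : 'I_n -> A) (v : 'I_n' -> A) (l : 'I_(n + n')) :=
  match fintype.split l with inl i => u i | inr i => v i end.
have pickl A (u : 'I_n -> A) v i : pick A u v (lshift n' i) = u i.
  by rewrite /pick (unsplitK (inl i)).
have pickr A (u : 'I_n -> A) v i : pick A u v (rshift n i) = v i.
  by rewrite /pick (unsplitK (inr i)).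
exists (n + n')%N, (pick _ c c'), (pick _ g g'); split.
  by move=> l; rewrite /pick; case: fintype.split.
apply/funext => x; rewrite big_split_ord /=.
by congr (_ + _); apply: eq_bigr => i _; rewrite ?pickl ?pickr.
Qed.

Lemma span_of_sum n (c : 'I_n -> K) (g : 'I_n -> T -> K) :
  (forall l, span_of S (g l)) -> span_of S (fun x => \sum_l c l * g l x).
Proof.
elim: n c g => [|n IH] c g gS.
  exists 0%N, c, g; split; first by case.
  by apply/funext => x; rewrite !big_ord0.
have -> : (fun x => \sum_l c l * g l x) = fun x => c ord0 * g ord0 x +
    \sum_(l < n) c (lift ord0 l) * g (lift ord0 l) x.
  by apply/funext => x; rewrite big_ord_recl.
by apply: span_ofD; [exact: span_ofZ|exact: IH].
Qed.

Lemma span_of_range n (e : 'I_n -> T -> K) f : span_of (range e) f ->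
  exists c, f = fun x => \sum_(l < n) c l * e l x.
Proof.
move=> [n' [c' [h [hP ->]]]].
have : forall j, exists l, h j = e l by move=> j; have [l _ <-] := hP j; exists l.
move=> /choice[j' j'P].
exists (fun l => \sum_(j | j' j == l) c' j); apply/funext => x.
rewrite (partition_big j' predT) //=; apply: eq_bigr => l _.
by rewrite mulr_suml; apply: eq_bigr => j /eqP <-; rewrite j'P.
Qed.

End Span.

(** Expand the determinant along the row of a new point [x]: as a function of [x]
    it is a combination of the [e l] with a nonzero coefficient by induction, and
    therefore nonzero somewhere. *)
Lemma unisolvent_points (K : numFieldType) (T : Type) n (e : 'I_n -> T -> K) :
  lin_indep e -> exists y : 'I_n -> T, \det (\matrix_(i, l) e l (y i)) != 0.
Proof.
elim: n e => [|n IH] e ind.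
  by exists (fun i : 'I_0 => match notF (ltn_ord i) with end); rewrite det_mx00 oner_eq0.
have [y yP] : exists y : 'I_n -> T, \det (\matrix_(i, l) e (lift ord0 l) (y i)) != 0.
  apply: (IH (fun l => e (lift ord0 l))) => c c0 l.
  pose c' l := if unlift ord0 l is Some l' then c l' else 0.
  have <- : c' (lift ord0 l) = c l by rewrite /c' liftK.
  apply: ind => x; rewrite big_ord_recl {1}/c' unlift_none mul0r add0r -[RHS](c0 x).
  by apply: eq_bigr => i _; rewrite /c' liftK.
pose C : 'M[K]_(n, n.+1) := \matrix_(i, l) e l (y i).
pose cof (l : 'I_n.+1) := (-1) ^+ ((ord0 : 'I_n.+1) + l)%N * \det (col' l C).
pose ext x (i : 'I_n.+1) := if unlift ord0 i is Some i' then y i' else x.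
have expand x : \det (\matrix_(i, l) e l (ext x i)) = \sum_l cof l * e l x.
  rewrite (expand_det_row _ ord0); apply: eq_bigr => l _.
  rewrite mxE /ext unlift_none mulrC /cofactor; congr (_ * \det _ * _).
  by apply/matrixP => i j; rewrite !mxE liftK.
have cof0 : cof ord0 != 0.
  rewrite /cof expr0 mul1r; apply: contra_neq yP => <-; congr (\det _).
  by apply/matrixP => i j; rewrite !mxE.
apply: contrapT => none; move/negP: cof0; apply; apply/eqP.
apply: (ind cof _ ord0) => x; rewrite -expand; apply/eqP/negPn/negP => nz.
by apply: none; exists (ext x).
Qed.

(** The row of coefficients that recovers the value at [x] from the values at
    the interpolation points; Cramer's rule writes it with the determinant in
    which one of the points is replaced by [x]. *)
Lemma interpolation (K : numFieldType) (T : Type) n (e : 'I_n -> T -> K)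
    (y : 'I_n -> T) (A := fun y : 'I_n -> T => \matrix_(i, l) e l (y i)) :
  \det (A y) != 0 ->
  exists la : 'I_n -> T -> K,
    (forall c x, \sum_l c l * e l x = \sum_i (\sum_l c l * e l (y i)) * la i x) /\
    (forall i, span_of (range e) (la i)) /\
    (forall i x, la i x * \det (A y) = \det (A (fun i' => if i' == i then x else y i'))).
Proof.
move=> dn0.
have Au : A y \in unitmx by rewrite unitmxE unitfE.
pose E x : 'rV[K]_n := \row_l e l x.
exists (fun i x => (E x *m invmx (A y)) 0 i); split => [c x|]; last split => [i|i x].
  pose C : 'cV[K]_n := \col_l c l.
  transitivity ((E x *m invmx (A y) *m (A y *m C)) 0 0).
    rewrite mulmxA mulmxKV // mxE; apply: eq_bigr => l _.
    by rewrite !mxE mulrC.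
  rewrite mxE; apply: eq_bigr => i _; rewrite mulrC; congr (_ * _).
  by rewrite mxE; apply: eq_bigr => l _; rewrite !mxE mulrC.
  exists n, (fun l => invmx (A y) l i), e; split; first by move=> l; exists l.
  by apply/funext => x; rewrite mxE; apply: eq_bigr => l _; rewrite mxE mulrC.
rewrite [RHS](expand_det_row _ i) mxE mulr_suml; apply: eq_bigr => l _.
rewrite /invmx Au !mxE eqxx -mulrA; congr (_ * _).
rewrite mulrAC mulVf // mul1r /cofactor; congr (_ * \det _).
by apply/matrixP => i' j; rewrite !mxE eq_sym (negbTE (neq_lift _ _)).
Qed.

(** On a finite set there are interpolation points that maximize the
    determinant; they recover a function with coefficients of modulus at most
    one, so that rounding the values at these points gives a net. *)
Lemma coordinate_net (R : realType) (k : scalar_kind) (I : finType) n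
    (e : 'I_n -> I -> scalar_field R k) (S d : R) (g : seq (scalar_field R k)) :
  lin_indep e -> (0 < n)%N ->
  (forall z, modulus z <= S -> exists2 v, v \in g & modulus (z - v) <= d / n%:R) ->
  exists2 G : seq (I -> scalar_field R k), (size G <= size g ^ n)%N &
    forall f, span_of (range e) f -> (forall i, modulus (f i) <= S) ->
      exists2 l, (l < size G)%N &
        forall i, modulus (f i - nth (fun=> 0) G l i) <= d.
Proof.
move=> ind n0 gP.
pose D (y : {ffun 'I_n -> I}) := modulus (\det (\matrix_(i, l) e l (y i))).
have [y1 y1P] := unisolvent_points ind.
pose y0 := [ffun i => y1 i].
have D0 : 0 < D y0.
  rewrite lt0r modulus_ge0 andbT; apply: contra_neq y1P => /modulus_eq0 <-.
  by congr (\det _); apply/matrixP => i j; rewrite !mxE ffunE.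
have [y _ ymax] := @arg_maxP _ R _ y0 predT D isT.
have Dy : 0 < D y by apply: lt_le_trans D0 (ymax _ _).
have dn0 : \det (\matrix_(i, l) e l (y i)) != 0.
  by apply: contraTneq Dy => eq0; rewrite /D eq0 modulus0 ltxx.
have [la [laP [_ la_det]]] := interpolation dn0.
have la1 i x : modulus (la i x) <= 1.
  rewrite -(ler_pM2r Dy) mul1r -modulusM la_det.
  apply: le_trans (ymax [ffun i' => if i' == i then x else y i'] isT).
  rewrite le_eqVlt; apply/orP; left; apply/eqP; congr (modulus (\det _)).
  by apply/matrixP => i' j; rewrite !mxE ffunE.
exists [seq (fun x => \sum_i nth 0 g (v i) * la i x) | v : {ffun 'I_n -> 'I_(size g)}].
  by rewrite size_map -cardE card_ffun !card_ord.
move=> f /span_of_range[c cP] fS.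
have : forall i, exists j : 'I_(size g), modulus (f (y i) - nth 0 g j) <= d / n%:R.
  move=> i; have [v vg vP] := gP _ (fS (y i)).
  have vs : (index v g < size g)%N by rewrite index_mem.
  by exists (Ordinal vs); rewrite /= nth_index.
move=> /choice[v vP].
pose v' := [ffun i => v i].
exists (index v' (enum {ffun 'I_n -> 'I_(size g)})).
  by rewrite size_map index_mem mem_enum.
move=> x; rewrite (nth_map v') ?index_mem ?mem_enum //.
rewrite nth_index ?mem_enum //.
rewrite {1}cP laP -sumrB; apply: le_trans (modulus_sum _ _ _) _.
have -> : d = \sum_(i < n) d / n%:R.
  by rewrite sumr_const card_ord -[RHS]mulr_natl mulrC divfK // pnatr_eq0 -lt0n.
apply: ler_sum => i _; rewrite -mulrBl modulusM ffunE.
have -> : \sum_l c l * e l (y i) = f (y i) by rewrite cP.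
apply: le_trans (vP i); rewrite -[leRHS]mulr1.
by apply: ler_wpM2l => //; exact: modulus_ge0.
Qed.

(** * Discretization on a finite probability space *)

Lemma level_count (R : realType) : exists2 a : R, 1 <= a &
  forall M : R, 1 <= M -> exists n : nat,
  [/\ (0 < n)%N, forall r, (r < n)%N -> level R r <= M, M < level R n &
      n%:R <= a * (1 + ln M)].
Proof.
exists (101 * 100); first lra.
move=> M M1; have M0 : 0 < M by lra.
have grow r : expR (r%:R / 101) <= 100 * level R r.
  rewrite /level [leRHS]mulrC divfK ?gt_eqF //.
  have -> : r%:R / 101 = r%:R * (1 / 101) :> R by ring.
  rewrite expRM_natl; apply: lerXn2r; rewrite ?nnegrE ?expR_ge0 //; try lra.
  rewrite -[1 / 101]opprK expRN -[leRHS]invrK lef_pV2 ?posrE ?expR_gt0 ?invr_gt0 //; try lra.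
  apply: le_trans (expR_ge1Dx _).
  by rewrite le_eqVlt; apply/orP; left; apply/eqP; field.
have ex : exists r, M < level R r.
  exists (Num.truncn (101 * (100 * M))).+1; set r := _.+1.
  have rM : 101 * (100 * M) < r%:R by exact: truncnS_gt.
  have := le_trans (expR_ge1Dx _) (grow r); lra.
have [n nP nmin] := ex_minnP ex.
have n0 : (0 < n)%N.
  by rewrite lt0n; apply: contraTneq nP => ->; rewrite /level expr0 -leNgt; lra.
exists n; split => // [r rn|].
  by rewrite leNgt; apply: contraTN rn => /nmin; rewrite -leqNgt.
have lM : level R n.-1 <= M.
  by rewrite leNgt; apply/negP => /nmin; rewrite -ltnS prednK // ltnn.
have : n.-1%:R / 101 <= ln (100 * M).
  rewrite -[leLHS]expRK ler_ln ?posrE ?expR_gt0 //; last by lra.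
  by apply: le_trans (grow _) _; rewrite ler_pM2l.
have l100 : ln (100 : R) <= 99 by apply: le_trans (le_ln1Dx _) _; lra.
have lM0 : 0 <= ln M by rewrite ln_ge0.
rewrite lnM ?posrE // -{2}(prednK n0) -[n.-1.+1%:R]natr1; lra.
Qed.

Section FiniteDiscretization.
Context (R : realType) (k : scalar_kind) (I : finType) (w : I -> R) (p : R).
Local Notation F := (scalar_field R k).
Local Notation nm := (@modulus R k).
Hypothesis w_ge0 : forall i, 0 <= w i.
Hypothesis w_sum : \sum_i w i = 1.
Hypothesis p_gt0 : 0 < p.

Definition mean_power (f : I -> F) : R := \sum_i w i * nm (f i) `^ p.

Lemma mean_power_ge0 f : 0 <= mean_power f.
Proof. by apply: sumr_ge0 => i _; rewrite mulr_ge0 ?powR_ge0. Qed.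

Lemma mean_power_clarkson (f f' : I -> F) : 2 <= p ->
  mean_power (fun i => 2^-1 * (f i + f' i)) +
  mean_power (fun i => 2^-1 * (f i - f' i)) <=
  (mean_power f + mean_power f') / 2.
Proof.
move=> p2; rewrite /mean_power -!big_split mulr_suml /=; apply: ler_sum => i _.
rewrite -!mulrDr -mulrA; apply: ler_wpM2l => //; exact: clarkson.
Qed.

(** Functions with mean power zero vanish, and the others are normalized. *)
Lemma discretize_finite (Y : set (I -> F)) (M D : R) (n m : nat) :
  0 < M ->
  (forall (c : F) f, Y f -> Y (fun i => c * f i)) ->
  (forall f i, Y f -> nm (f i) `^ p <= M * mean_power f) ->
  (0 < n)%N -> (forall r, (r < n)%N -> level R r <= M) -> M < level R n ->
  (forall r, level R r <= M -> exists2 G : seq (I -> F),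
     (size G)%:R <= expR (D / level R r) &
     forall f, Y f -> mean_power f <= 1 -> exists2 l, (l < size G)%N &
       forall i, nm (f i - nth (fun=> 0) G l i) <= level_gap p r) ->
  8 * n%:R ^+ 2 * (D + 2 * n%:R * M) <= m%:R ->
  exists z : 'I_m -> I, forall f, Y f ->
    9 / 10 * mean_power f * m%:R <= \sum_j nm (f (z j)) `^ p <=
    11 / 10 * mean_power f * m%:R.
Proof.
move=> M0 YZ Ynik n0 level_le level_gt net m_large.
have : forall r, exists G : seq (I -> F), level R r <= M ->
    (size G)%:R <= expR (D / level R r) /\
    (forall f, Y f -> mean_power f <= 1 -> exists2 l, (l < size G)%N &
       forall i, nm (f i - nth (fun=> 0) G l i) <= level_gap p r).
  move=> r; have [rM|rM] := pselect (level R r <= M); last by exists [::].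
  by have [G ? ?] := net r rM; exists G.
move=> /choice[G GP].
pose A : set (I -> R) := [set a | exists2 f, Y f /\ mean_power f = 1 & a = nm \o f].
have [|||r rn|r rn|z zP] := @discretize_by_nets R I w p M D n m A
   (fun r => [seq nm \o h | h <- G r]) w_ge0 w_sum p_gt0 n0 level_le level_gt
   _ _ _ _ _ m_large.
- by move=> a i [f _ ->]; exact: modulus_ge0.
- by move=> a i [f [Yf f1] ->]; rewrite /=; apply: le_trans (Ynik f i Yf) _; rewrite f1 mulr1.
- by move=> a [f [Yf f1] ->].
- move=> a [f [Yf f1] ->]; have [_ GrP] := GP r (level_le r rn).
  have [|l ls lP] := GrP f Yf; first by rewrite f1.
  exists l; rewrite ?size_map // => i.
  rewrite (nth_map (fun=> 0)) //=; exact: le_trans (modulusB_lip _ _) (lP i).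
- by rewrite size_map; have [] := GP r (level_le r rn).
exists z => f Yf.
have [f0|f0] := eqVneq (mean_power f) 0.
  have z0 i : nm (f i) `^ p = 0.
    by apply/eqP; rewrite eq_le powR_ge0 andbT (le_trans (Ynik f i Yf)) // f0 mulr0.
  by rewrite f0 !mulr0 mul0r big1 ?lexx // => j _; rewrite z0.
have fpos : 0 < mean_power f by rewrite lt0r f0 mean_power_ge0.
pose c : F := of_real k ((mean_power f)^-1 `^ p^-1).
have cp : nm c `^ p = (mean_power f)^-1.
  rewrite modulus_of_real ger0_norm ?powR_ge0 // -powRrM mulVf ?gt_eqF // powRr1 //.
  by rewrite invr_ge0 ltW.
have scale i : nm (c * f i) `^ p = (mean_power f)^-1 * nm (f i) `^ p.
  by rewrite modulusM powRM ?modulus_ge0 // cp.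
have /zP : A (nm \o (fun i => c * f i)).
  exists (fun i => c * f i) => //; split; first exact: YZ.
  rewrite /mean_power; under eq_bigr do rewrite scale mulrCA.
  by rewrite -mulr_sumr mulVf.
rewrite /=; under eq_bigr do rewrite scale.
rewrite -mulr_sumr ler_pdivlMl // ler_pdivrMl //.
by rewrite !(mulrCA (mean_power f)) !mulrA.
Qed.

End FiniteDiscretization.

Section NetSizes.
Context (R : realType) (p : R).
Hypothesis p1 : 1 <= p.

Let p_gt0 : 0 < p.
Proof. exact: lt_le_trans p1. Qed.

Let pV_ge0 : 0 <= p^-1.
Proof. by rewrite invr_ge0 ltW. Qed.

Let pV_le1 : p^-1 <= 1.
Proof. by rewrite invf_le1. Qed.

Let root_gt1 : 1 < (1 + 1 / 100 : R) `^ p^-1.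
Proof.
have : (1 : R) `^ p^-1 < (1 + 1 / 100) `^ p^-1.
  by apply: gt0_ltr_powR; rewrite ?nnegrE ?invr_gt0 //; lra.
by rewrite powR1.
Qed.

Definition gap_ratio : R := ((1 + 1 / 100 : R) `^ p^-1 - 1) / 2.

Lemma gap_ratio_gt0 : 0 < gap_ratio.
Proof. by rewrite divr_gt0 // subr_gt0. Qed.

Lemma gap_ratio_le1 : gap_ratio <= 1.
Proof.
have : (1 + 1 / 100 : R) `^ p^-1 <= 1 + 1 / 100.
  by apply: ler1_powR => //; lra.
by rewrite /gap_ratio; lra.
Qed.

Lemma level_gapE r : level_gap p r = gap_ratio * level R r `^ p^-1.
Proof.
rewrite /level_gap levelS powRM ?(ltW (level_gt0 _ _)) //.
by rewrite /gap_ratio; field.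
Qed.

Lemma level_gap_gt0 r : 0 < level_gap p r.
Proof. by rewrite level_gapE mulr_gt0 ?gap_ratio_gt0 ?powR_gt0 ?level_gt0. Qed.

Lemma level_gap_pow r : level_gap p r `^ p = gap_ratio `^ p * level R r.
Proof.
rewrite level_gapE powRM ?powR_ge0 ?(ltW gap_ratio_gt0) //.
by rewrite -powRrM mulVf ?powRr1 ?(ltW (level_gt0 _ _)) // gt_eqF.
Qed.

Lemma root_le_gap (M : R) r : 1 <= M -> level R r <= M ->
  level_gap p r <= M `^ p^-1 /\ M `^ p^-1 / level_gap p r <= 100 * M / gap_ratio.
Proof.
move=> M1 rM; have g0 := gap_ratio_gt0; have g1 := gap_ratio_le1.
have L0 := level_gt0 R r; have u0 : 0 < level R r `^ p^-1 by exact: powR_gt0.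
split.
  rewrite level_gapE -[leRHS]mul1r; apply: ler_pM => //; first exact: ltW.
    exact: ltW.
  by apply: ge0_ler_powR; rewrite ?nnegrE //; lra.
have gu0 : 0 < gap_ratio * level R r `^ p^-1 by exact: mulr_gt0.
rewrite level_gapE ler_pdivrMr // mulrA divfK ?(gt_eqF g0) //.
have h : 1 / 100 <= level R r.
  by have := level_le R (leq0n r); rewrite {1}/level expr0.
apply: (@le_trans _ _ ((100 * M) `^ p^-1 * level R r `^ p^-1)).
  rewrite -powRM; [|lra|lra].
  apply: ge0_ler_powR; rewrite ?nnegrE //; [lra| |].
    by apply: mulr_ge0; lra.
  by nra.
apply: ler_wpM2r; first exact: ltW.
by apply: ler1_powR => //; lra.
Qed.

End NetSizes.

Section TwoStages.
Context (R : realType) (p : R).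
Hypothesis p2 : 2 <= p.

Let p_gt0 : 0 < p.
Proof. by apply: lt_le_trans p2. Qed.

Let p_ge1 : 1 <= p.
Proof. by apply: le_trans p2; rewrite ler1n. Qed.

Local Notation kappa := (gap_ratio p).

Let kappa_gt0 : 0 < kappa := gap_ratio_gt0 p_ge1.
Let kappa_le1 : kappa <= 1 := gap_ratio_le1 p_ge1.

Let kappaV_ge1 : 1 <= kappa^-1.
Proof. by rewrite invf_ge1. Qed.

Let le_root_pow (M x : R) : 0 <= M -> 0 <= x -> x `^ p <= M -> x <= M `^ p^-1.
Proof.
move=> M0 x0 xM; rewrite -[leLHS]powRr1 // -(@mulfV _ p) ?gt_eqF // powRrM.
by apply: ge0_ler_powR; rewrite ?nnegrE ?powR_ge0 ?invr_ge0 ?(ltW p_gt0).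
Qed.

Let ceil_le (x : R) : 0 <= x -> (Num.truncn x).+1%:R <= x + 1.
Proof. by move=> x0; rewrite -natr1 lerD2r; have /andP[] := truncn_itv x0. Qed.

Let le_expR_ln (c M : R) (j : nat) : 1 <= M -> j%:R <= c ->
  c * M ^+ j <= expR (c * (1 + ln M)).
Proof.
move=> M1 jc; have M0 : 0 < M by lra.
have c0 : 0 <= c by apply: le_trans jc.
have l0 : 0 <= ln M by rewrite ln_ge0.
rewrite mulrDr mulr1 expRD; apply: ler_pM => //.
  by rewrite exprn_ge0 // ltW.
  by apply: le_trans (expR_ge1Dx _); rewrite lerDr.
apply: (@le_trans _ _ (expR (j%:R * ln M))).
  by rewrite expRM_natl lnK.
by rewrite ler_expR; apply: ler_wpM2r.
Qed.

(** A first sample of polynomial size, from the coordinate net. Its only purpose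
    is to bound the number of points by a power of [M]. *)
Lemma crude_discretization : exists2 c : R, 1 <= c &
  forall (k : scalar_kind) (I : finType) (w : I -> R) n (e : 'I_n -> I -> scalar_field R k) (M : R),
  (forall i, 0 <= w i) -> \sum_i w i = 1 ->
  lin_indep e -> (0 < n)%N -> 1 <= M -> n%:R <= M ->
  (forall f i, span_of (range e) f -> modulus (f i) `^ p <= M * mean_power w p f) ->
  exists (m : nat) (z : 'I_m -> I), [/\ (0 < m)%N, m%:R <= c * M ^+ 5 &
    forall f, span_of (range e) f ->
    9 / 10 * mean_power w p f * m%:R <= \sum_j modulus (f (z j)) `^ p <=
    11 / 10 * mean_power w p f * m%:R].
Proof.
have [a a1 level_count] := level_count R; have a0 : 0 < a by lra.
pose c0 : R := 36 * (100 * kappa^-1) ^+ 2.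
have c04 : 4 <= c0.
  have := kappaV_ge1; rewrite /c0 expr2; nra.
pose c : R := 8 * a ^+ 2 * (c0 + 2 * a) + 1.
have a20 : 0 <= 8 * a ^+ 2 * (c0 + 2 * a).
  by rewrite !mulr_ge0 ?exprn_ge0 ?addr_ge0 //; lra.
exists c; first by rewrite /c lerDr.
move=> k I w n e M w0 w1 ind n0 M1 nM nik.
have M0 : 0 < M by lra.
pose L := 1 + ln M.
have L1 : 1 <= L by rewrite lerDl ln_ge0.
have LM : L <= M.
  have : -1 < M - 1 by lra.
  by move=> /le_ln1Dx; rewrite [1 + _]addrC subrK /L; lra.
have [N [N0 level_leM level_gtM N_le]] := level_count M M1.
pose D := M * M * (c0 * L).
have net r : level R r <= M -> exists2 G : seq (I -> scalar_field R k),
     (size G)%:R <= expR (D / level R r) &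
     forall f, span_of (range e) f -> mean_power w p f <= 1 ->
       exists2 l, (l < size G)%N &
       forall i, modulus (f i - nth (fun=> 0) G l i) <= level_gap p r.
  move=> rM; have L0 := level_gt0 R r.
  have [gapM rootM] := root_le_gap p_ge1 M1 rM; have gap0 := level_gap_gt0 p_ge1 r.
  have n0' : (0 : R) < n%:R by rewrite ltr0n.
  have n1' : (1 : R) <= n%:R by rewrite ler1n.
  have d0 : 0 < level_gap p r / n%:R by rewrite divr_gt0.
  have dS : level_gap p r / n%:R <= M `^ p^-1.
    by apply: le_trans gapM; rewrite ler_pdivrMr // ler_peMr // ltW.
  have [g gs gP] := disc_grid k d0 dS.
  have [G Gs GP] := coordinate_net ind n0 gP.
  exists G; last first.
    move=> f Yf f1; apply: GP => // i.
    apply: le_root_pow; [exact: ltW|exact: modulus_ge0|].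
    by apply: le_trans (nik f i Yf) _; rewrite -[leRHS]mulr1 ler_pM2l.
  apply: (@le_trans _ _ ((size g)%:R ^+ n)); first by rewrite -natrX ler_nat.
  apply: (@le_trans _ _ (expR (c0 * L) ^+ n)).
    apply: lerXn2r; rewrite ?nnegrE ?expR_ge0 //.
    apply: le_trans (@le_expR_ln c0 M 4 M1 c04).
    apply: le_trans gs _; rewrite /c0.
    have -> : 36 * (M `^ p^-1 / (level_gap p r / n%:R)) ^+ 2 =
        36 * ((M `^ p^-1 / level_gap p r) * n%:R) ^+ 2.
      by rewrite invf_div; congr (_ * _ ^+ 2); ring.
    have h0 : 0 <= M `^ p^-1 / level_gap p r by rewrite divr_ge0 ?powR_ge0 // ltW.
    have hn : 0 <= M `^ p^-1 / level_gap p r * n%:R by exact: mulr_ge0.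
    have h : M `^ p^-1 / level_gap p r * n%:R <= 100 * M / kappa * M by exact: ler_pM.
    have -> : 36 * (100 * kappa^-1) ^+ 2 * M ^+ 4 = 36 * (100 * M / kappa * M) ^+ 2.
      by ring.
    rewrite ler_pM2l //; apply: lerXn2r => //; rewrite nnegrE //.
    exact: le_trans h.
  rewrite -expRM_natl ler_expR ler_pdivlMr // /D.
  have cL0 : 0 <= c0 * L by apply: mulr_ge0; lra.
  rewrite mulrAC; apply: ler_wpM2r => //.
  by apply: ler_pM => //; exact: ltW.
pose X := 8 * N%:R ^+ 2 * (D + 2 * N%:R * M).
have D0 : 0 <= D by rewrite /D; do 2![apply: mulr_ge0; try lra].
have X0 : 0 <= X.
  apply: mulr_ge0; first by rewrite mulr_ge0 ?sqr_ge0.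
  by rewrite addr_ge0 // !mulr_ge0 // ltW.
have m_large : X <= (Num.truncn X).+1%:R by apply/ltW/truncnS_gt.
have [z zP] := discretize_finite w0 w1 p_gt0 M0 (fun a f => @span_ofZ _ _ _ a f) nik N0 level_leM level_gtM net m_large.
exists (Num.truncn X).+1, z; split => //.
apply: le_trans (ceil_le X0) _.
have N_leM : N%:R <= a * M by apply: le_trans N_le _; rewrite ler_pM2l.
have N0' : (0 : R) <= N%:R by [].
have : X <= 8 * (a * M) ^+ 2 * (c0 * M ^+ 3 + 2 * a * M ^+ 2).
  rewrite /X; apply: ler_pM.
  - by rewrite mulr_ge0 ?exprn_ge0.
  - by rewrite addr_ge0 // !mulr_ge0 // ltW.
  - by rewrite ler_pM2l // lerXn2r ?nnegrE // mulr_ge0 //; lra.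
  - apply: lerD.
      have -> : c0 * M ^+ 3 = M * M * (c0 * M) by ring.
      rewrite /D; apply: ler_wpM2l; first by rewrite mulr_ge0 // ltW.
      by apply: ler_wpM2l => //; lra.
    have -> : 2 * a * M ^+ 2 = 2 * (a * M) * M by ring.
    by rewrite ler_pM2r // ler_pM2l.
have M5 : 1 <= M ^+ 5 by exact: exprn_ege1.
have : M ^+ 4 <= M ^+ 5 by apply: ler_weXn2l.
move=> M45 XM.
have -> : c * M ^+ 5 = 8 * a ^+ 2 * (c0 * M ^+ 5) + 8 * a ^+ 2 * 2 * a * M ^+ 5 + M ^+ 5.
  by rewrite /c; ring.
apply: lerD => //; apply: le_trans XM _.
have -> : 8 * (a * M) ^+ 2 * (c0 * M ^+ 3 + 2 * a * M ^+ 2) =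
  8 * a ^+ 2 * (c0 * M ^+ 5) + 8 * a ^+ 2 * 2 * a * M ^+ 4 by ring.
by rewrite lerD2l; apply: ler_wpM2l => //; rewrite !mulr_ge0 ?sqr_ge0 // ltW.
Qed.

(** On polynomially many points the net from uniform convexity has the size
    that makes the three logarithms: one from the size of the net and two from
    the number of levels. *)
Lemma fine_discretization (c1 : R) : 1 <= c1 -> exists2 c : R, 0 < c &
  forall (k : scalar_kind) (I : finType) (w : I -> R)
    (Y : set (I -> scalar_field R k)) (M : R),
  (forall i, 0 <= w i) -> \sum_i w i = 1 -> 1 <= M -> #|I|%:R <= c1 * M ^+ 5 ->
  (forall (a : scalar_field R k) f, Y f -> Y (fun i => a * f i)) ->
  (forall f f', Y f -> Y f' -> Y (fun i => f i + f' i)) ->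
  (forall f i, Y f -> modulus (f i) `^ p <= M * mean_power w p f) ->
  exists (m : nat) (z : 'I_m -> I), [/\ (0 < m)%N, m%:R <= c * M * (1 + ln M) ^+ 3 &
    forall f, Y f ->
    9 / 10 * mean_power w p f * m%:R <= \sum_j modulus (f (z j)) `^ p <=
    11 / 10 * mean_power w p f * m%:R].
Proof.
move=> c11.
have [a a1 level_count] := level_count R; have a0 : 0 < a by lra.
pose c2 : R := 36 * (400 * kappa^-1) ^+ 2.
have c27 : 7 <= c2.
  have := kappaV_ge1; rewrite /c2 expr2; nra.
pose c3 : R := 1 + c1 * c2.
have c37 : 7 <= c3.
  have : c2 <= c1 * c2 by rewrite ler_peMl //; lra.
  by rewrite /c3; lra.
pose q : R := 4 `^ p / kappa `^ p.
have q0 : 0 <= q by rewrite divr_ge0 ?powR_ge0.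
pose c : R := 8 * a ^+ 2 * ((q + 1) * c3 + 2 * a) + 1.
have qc0 : 0 <= (q + 1) * c3 by apply: mulr_ge0; lra.
have a20 : 0 <= 8 * a ^+ 2 * ((q + 1) * c3 + 2 * a).
  by apply: mulr_ge0; [rewrite mulr_ge0 ?sqr_ge0|lra].
exists c; first by rewrite /c ltr_wpDl.
move=> k I w Y M w0 w1 M1 cardI YZ YD nik.
have M0 : 0 < M by lra.
pose L := 1 + ln M.
have L1 : 1 <= L by rewrite lerDl ln_ge0.
have [N [N0 level_leM level_gtM N_le]] := level_count M M1.
pose D := (q + 1) * c3 * M * L.
have Ymid f f' : Y f -> Y f' -> Y (fun i => 2^-1 * (f i + f' i)).
  by move=> Yf Yf'; apply: YZ; exact: YD.
have Yhdiff f f' : Y f -> Y f' -> Y (fun i => 2^-1 * (f i - f' i)).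
  move=> Yf Yf'; apply: (YZ); apply: (YD f (fun i => - f' i)) => //.
  have -> : (fun i => - f' i) = (fun i => -1 * f' i) by apply/funext => i; rewrite mulN1r.
  exact: YZ.
have net r : level R r <= M -> exists2 G : seq (I -> scalar_field R k),
     (size G)%:R <= expR (D / level R r) &
     forall f, Y f -> mean_power w p f <= 1 ->
       exists2 l, (l < size G)%N &
       forall i, modulus (f i - nth (fun=> 0) G l i) <= level_gap p r.
  move=> rM; have L0 := level_gt0 R r.
  have [gapM rootM] := root_le_gap p_ge1 M1 rM; have gap0 := level_gap_gt0 p_ge1 r.
  have d0 : 0 < level_gap p r / 4 by rewrite divr_gt0.
  have dS : level_gap p r / 4 <= M `^ p^-1 by apply: le_trans gapM; lra.
  have [g gs gP] := disc_grid k d0 dS.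
  pose n := (Num.truncn (M * (4 / level_gap p r) `^ p)).+1.
  have n_large : M * (4 / level_gap p r) `^ p < n%:R by exact: truncnS_gt.
  have gap_pow : (4 / level_gap p r) `^ p = q / level R r.
    rewrite powRM ?invr_ge0 ?(ltW gap0) //.
    rewrite -(powR_inv1 (ltW gap0)) powRAC powR_inv1 ?powR_ge0 //.
    by rewrite level_gap_pow // /q invfM mulrA.
  have n_le : n%:R <= (q + 1) * (M / level R r).
    have : n%:R <= M * (4 / level_gap p r) `^ p + 1.
      by apply: ceil_le; rewrite mulr_ge0 ?powR_ge0 // ltW.
    rewrite gap_pow => h; apply: le_trans h _.
    have : 1 <= M / level R r by rewrite ler_pdivlMr // mul1r.
    rewrite mulrDl mul1r mulrCA lerD2l //.
  have cov f i : Y f -> mean_power w p f <= 1 ->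
      exists2 v, v \in g & modulus (f i - v) <= level_gap p r / 4.
    move=> Yf f1; apply: gP; apply: le_root_pow; [exact: ltW|exact: modulus_ge0|].
    by apply: le_trans (nik f i Yf) _; rewrite -[leRHS]mulr1 ler_pM2l.
  have [G Gs GP] := uniform_convexity_net p_gt0 gap0 M0 (mean_power_ge0 p w0)
    (fun f f' => mean_power_clarkson w0 f f' p2) Ymid Yhdiff nik cov n_large.
  exists G => //.
  apply: (@le_trans _ _ ((1 + #|I|%:R * (size g)%:R) ^+ n)).
    by rewrite -natrM -(natrD _ 1%N) -natrX ler_nat.
  apply: (@le_trans _ _ (expR (c3 * L) ^+ n)).
    apply: lerXn2r; rewrite ?nnegrE ?expR_ge0 //.
    apply: le_trans (@le_expR_ln c3 M 7 M1 c37).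
    have M7 : 1 <= M ^+ 7 by exact: exprn_ege1.
    rewrite /c3 mulrDl mul1r; apply: lerD => //.
    have -> : c1 * c2 * M ^+ 7 = (c1 * M ^+ 5) * (c2 * M ^+ 2) by ring.
    apply: ler_pM => //; apply: le_trans gs _.
    have -> : M `^ p^-1 / (level_gap p r / 4) = 4 * (M `^ p^-1 / level_gap p r).
      by rewrite invf_div; ring.
    have -> : c2 * M ^+ 2 = 36 * (4 * (100 * M / kappa)) ^+ 2 by rewrite /c2; ring.
    have h0 : 0 <= M `^ p^-1 / level_gap p r by rewrite divr_ge0 ?powR_ge0 // ltW.
    have h1 : 0 <= 100 * M / kappa by exact: le_trans rootM.
    rewrite ler_pM2l //; apply: lerXn2r; rewrite ?nnegrE.
    - exact: mulr_ge0.
    - exact: mulr_ge0.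
    - by rewrite ler_pM2l.
  rewrite -expRM_natl ler_expR.
  have -> : D / level R r = (q + 1) * (M / level R r) * (c3 * L) by rewrite /D; ring.
  by apply: ler_wpM2r => //; apply: mulr_ge0; lra.
pose X := 8 * N%:R ^+ 2 * (D + 2 * N%:R * M).
have N0' : (0 : R) <= N%:R by [].
have D0 : 0 <= D by rewrite /D; apply: mulr_ge0; [apply: mulr_ge0|]; lra.
have X0 : 0 <= X.
  apply: mulr_ge0; first by rewrite mulr_ge0 ?sqr_ge0.
  by rewrite addr_ge0 // !mulr_ge0 // ltW.
have m_large : X <= (Num.truncn X).+1%:R by apply/ltW/truncnS_gt.
have [z zP] := discretize_finite w0 w1 p_gt0 M0 YZ nik N0 level_leM level_gtM net m_large.
exists (Num.truncn X).+1, z; split => //.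
apply: le_trans (ceil_le X0) _; rewrite -/L.
have : X <= 8 * (a * L) ^+ 2 * (D + 2 * (a * L) * M).
  rewrite /X; apply: ler_pM.
  - by rewrite mulr_ge0 ?exprn_ge0.
  - by rewrite addr_ge0 // !mulr_ge0 // ltW.
  - by rewrite ler_pM2l // lerXn2r ?nnegrE // mulr_ge0 //; lra.
  - by rewrite lerD2l ler_pM2r // ler_pM2l.
have ML : 1 <= M * L ^+ 3.
  by rewrite -[leLHS]mul1r; apply: ler_pM => //; exact: exprn_ege1.
move=> XM.
have -> : c * M * L ^+ 3 = 8 * (a * L) ^+ 2 * (D + 2 * (a * L) * M) + M * L ^+ 3.
  by rewrite /c /D; ring.
exact: lerD.
Qed.

(** The points are sampled from a first sample, which satisfies the same
    inequality with [2 M] in place of [M]. *)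
Theorem finite_discretization : exists2 C : R, 0 < C &
  forall (k : scalar_kind) (I : finType) (w : I -> R) n (e : 'I_n -> I -> scalar_field R k) (M : R),
  (forall i, 0 <= w i) -> \sum_i w i = 1 ->
  lin_indep e -> (0 < n)%N -> 1 <= M -> n%:R <= M ->
  (forall f i, span_of (range e) f -> modulus (f i) `^ p <= M * mean_power w p f) ->
  exists (m : nat) (z : 'I_m -> I), [/\ (0 < m)%N, m%:R <= C * M * (1 + ln M) ^+ 3 &
    forall f, span_of (range e) f ->
    4 / 5 * mean_power w p f * m%:R <= \sum_j modulus (f (z j)) `^ p <=
    5 / 4 * mean_power w p f * m%:R].
Proof.
have [c1 c11 crude] := crude_discretization.
have [c c0 fine_disc] := fine_discretization c11.
exists (16 * c); first by rewrite mulr_gt0.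
move=> k I w n e M w0 w1 ind n0 M1 nM nik.
have M0 : 0 < M by lra.
have [m1 [z1 [m10 m1M z1P]]] := crude k I w n e M w0 w1 ind n0 M1 nM nik.
have m1p : (0 : R) < m1%:R by rewrite ltr0n.
pose w' (_ : 'I_m1) : R := m1%:R^-1.
have w'0 i : 0 <= w' i by rewrite invr_ge0.
have w'1 : \sum_i w' i = 1.
  by rewrite sumr_const card_ord -[LHS]mulr_natl mulfV // gt_eqF.
pose Y : set ('I_m1 -> scalar_field R k) :=
  [set f | exists2 h, span_of (range e) h & f = h \o z1].
have meanE h : mean_power w' p (h \o z1) = (\sum_j modulus (h (z1 j)) `^ p) / m1%:R.
  by rewrite /mean_power -mulr_sumr mulrC.
have mean_ge h : span_of (range e) h ->
    9 / 10 * mean_power w p h <= mean_power w' p (h \o z1) <= 11 / 10 * mean_power w p h.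
  by move=> /z1P; rewrite meanE ler_pdivlMr // ler_pdivrMr.
have mean0 h := mean_power_ge0 p w0 (h : I -> scalar_field R k).
have [|||||m [z [mp mM zP]]] := fine_disc k 'I_m1 w' Y (2 * M) w'0 w'1.
- lra.
- rewrite card_ord; apply: le_trans m1M _; apply: ler_wpM2l; first by lra.
  by apply: lerXn2r; rewrite ?nnegrE; lra.
- by move=> a f [h hs ->]; exists (fun i => a * h i) => //; exact: span_ofZ.
- move=> f f' [h hs ->] [h' hs' ->]; exists (fun i => h i + h' i) => //.
  exact: span_ofD.
- move=> f i [h hs ->]; apply: le_trans (nik h (z1 i) hs) _.
  have /andP[h1 _] := mean_ge h hs.
  rewrite -mulrA mulrCA ler_pM2l //; have := mean0 h; lra.
exists m, (z1 \o z); split => //.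
  apply: le_trans mM _.
  have l0 : 0 <= ln M by rewrite ln_ge0.
  have l2 : ln (2 : R) <= 1 by apply: le_trans (le_ln1Dx _) _; lra.
  have l2' : 0 <= ln (2 : R) by rewrite ln_ge0 // ler1n.
  have lM : 1 + ln (2 * M) <= 2 * (1 + ln M) by rewrite lnM ?posrE //; lra.
  have -> : 16 * c * M * (1 + ln M) ^+ 3 = c * (2 * M) * (2 * (1 + ln M)) ^+ 3 by ring.
  apply: ler_wpM2l; first by rewrite !mulr_ge0 // ltW.
  apply: lerXn2r => //; rewrite nnegrE; last lra.
  rewrite lnM ?posrE //; lra.
move=> f fs.
have /andP[h1 h2] := mean_ge f fs.
have /andP[h3 h4] : 9 / 10 * mean_power w' p (f \o z1) * m%:R <=
   \sum_j modulus ((f \o z1) (z j)) `^ p <= 11 / 10 * mean_power w' p (f \o z1) * m%:R.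
  by apply: zP; exists f.
have := mean0 f; have mp' : (0 : R) < m%:R by rewrite ltr0n.
move: h1 h2 h3 h4; rewrite /=; set a := mean_power w p f; set b := mean_power w' p _.
set S := \sum_j _ => h1 h2 h3 h4 a0.
apply/andP; split.
  apply: le_trans h3; rewrite ler_pM2r //; lra.
apply: le_trans h4 _; rewrite ler_pM2r //; lra.
Qed.

End TwoStages.

(** * Bounded continuous functions and finite measurable partitions *)

Lemma modulusB_continuous (R : realType) (k : scalar_kind) (T : topologicalType)
    (f : T -> scalar_field R k) v :
  continuous f -> continuous (fun x => modulus (f x - v) : R).
Proof.
move=> cf x; apply/cvgrPdist_lt => e e0.
have /cvgrPdist_lt /(_ (of_real k e) (of_real_gt0 k e0)) := cf x.
apply: filterS => y; rewrite norm_lt_of_real; apply: le_lt_trans.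
apply: le_trans (modulusB_lip _ _) _.
by rewrite opprB addrA subrK.
Qed.

Lemma modulus_continuous (R : realType) (k : scalar_kind) (T : topologicalType)
    (f : T -> scalar_field R k) :
  continuous f -> continuous (fun x => modulus (f x) : R).
Proof.
by move=> /(modulusB_continuous (v := 0)); under eq_fun do rewrite subr0.
Qed.

Lemma points_compact (R : realType) (A : compact_domain R) :
  compact [set: points A].
Proof.
move=> F FF _.
have [|p [Ap Fp]] := dom_compact (c := A) (F := (set_val : points A -> _) x @[x --> F]).
  by apply: (@filterS _ F _ setT) => [x _|]; [exact: set_valP|exact: filterT].
exists (SigSub (mem_set Ap)); split => // V U FV.
rewrite nbhsE => -[W [[B oB <-] WB] WU].
have [||_ [[x Vx <-] Bx]] := Fp [set (set_val : points A -> _) x | x in V] B.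
- by apply: (@filterS _ F _ V) => // x Vx; exists x.
- by apply: open_nbhs_nbhs; split.
by exists x; split => //; exact: WU.
Qed.

Lemma continuous_modulus_bounded (R : realType) (k : scalar_kind)
    (A : compact_domain R) (f : points A -> scalar_field R k) :
  continuous f -> exists S : R, forall x, modulus (f x) <= S.
Proof.
move=> /modulus_continuous cf.
have : compact [set modulus (f x) | x in [set: points A]].
  apply: continuous_compact; last exact: points_compact.
  by apply: continuous_subspaceT.
move=> /compact_bounded[M [_ /(_ (M + 1)) b]].
exists (M + 1) => x; have : `|modulus (f x)| <= M + 1.
  by apply: b; [rewrite ltrDl|exists x].
by rewrite ger0_norm // modulus_ge0.
Qed.

Lemma measurable_cells (R : realType) (k : scalar_kind) (A : compact_domain R) n
    (h : 'I_n -> points A -> scalar_field R k) (d : R) :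
  (forall l, continuous (h l)) -> 0 < d ->
  exists (J : finType) (c : borel (points A) -> J),
    (forall a, measurable (c @^-1` [set a])) /\
    forall l x y, c x = c y -> modulus (h l x - h l y) <= d.
Proof.
move=> hc d0.
have [S SP] := choice (fun l => continuous_modulus_bounded (hc l)).
pose S' := d + \sum_l `|S l|.
have S'P l x : modulus (h l x) <= S'.
  apply: le_trans (SP l x) _; apply: le_trans (ler_norm _) _.
  rewrite /S' (bigD1 l) //= addrCA lerDl addr_ge0 ?sumr_ge0 //; exact: ltW.
have d40 : 0 < d / 4 by rewrite divr_gt0.
have dS : d / 4 <= S'.
  apply: (@le_trans _ _ d); first lra.
  by rewrite lerDl sumr_ge0.
have [g _ gP] := disc_grid k d40 dS.
(* A cell records which grid points are close to the values of the functions. *)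
pose J := {ffun 'I_n * 'I_(size g) -> bool}.
pose c (x : borel (points A)) : J :=
  [ffun j : 'I_n * 'I_(size g) => modulus (h j.1 x - nth 0 g j.2) < d / 2].
exists J, c; split => [a|l x y cxy].
  have -> : c @^-1` [set a] = \bigcap_(j in [set: 'I_n * 'I_(size g)])
      [set x | (modulus (h j.1 x - nth 0 g j.2) < d / 2) = a j].
    apply/seteqP; split => [x /= <- j _|x /= xP]; first by rewrite /= ffunE.
    by apply/ffunP => j; rewrite ffunE; apply: xP.
  apply: fin_bigcap_measurable => // j _.
  have mlt : measurable [set x : borel (points A) | modulus (h j.1 x - nth 0 g j.2) < d / 2].
    apply: sub_sigma_algebra.
    have /continuousP := modulusB_continuous (v := nth 0 g j.2) (hc j.1).
    by move=> /(_ [set r | r < d / 2]); apply; exact: open_lt.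
  case: (a j) => //; rewrite [X in measurable X](_ : _ = ~` [set x : borel (points A) | modulus (h j.1 x - nth 0 g j.2) < d / 2]).
    exact: measurableC.
  by apply/seteqP; split => x /=; [move=> ->|move/negP/negbTE].
have [v vg vP] := gP _ (S'P l x).
have vs : (index v g < size g)%N by rewrite index_mem.
have := congr1 (fun u : J => u (l, Ordinal vs)) cxy; rewrite !ffunE /= nth_index //.
have -> : modulus (h l x - v) < d / 2 by apply: le_lt_trans vP _; lra.
move=> /esym yv.
have : modulus (h l x - h l y) <= modulus (h l x - v) + modulus (h l y - v).
  by rewrite (modulusBC (h l y)); apply: le_trans (modulusD _ _); rewrite addrA subrK.
lra.
Qed.

(** * Integrals as limits of finite sums *)

Section IntegralCells.
Context d (T : measurableType d) (R : realType) (P : probability T R).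
Context (J : finType) (c : T -> J).
Hypothesis c_meas : forall a, measurable (c @^-1` [set a]).

Definition cell_weight a : R := fine (P (c @^-1` [set a])).

Lemma cell_weightE a : P (c @^-1` [set a]) = (cell_weight a)%:E.
Proof. by rewrite /cell_weight fineK // fin_num_measure. Qed.

Lemma cell_weight_ge0 a : 0 <= cell_weight a.
Proof. by rewrite fine_ge0. Qed.

Lemma integral_step (H : J -> R) : (forall a, 0 <= H a) ->
  (\int[P]_x (H (c x))%:E = (\sum_a cell_weight a * H a)%:E)%E.
Proof.
move=> H0.
have -> : (\int[P]_x (H (c x))%:E =
    \int[P]_x \sum_(a <- enum J) (H a)%:E * (\1_(c @^-1` [set a]) x)%:E)%E.
  apply: eq_integral => x _.
  rewrite big_enum /= (bigD1 (c x)) //= indicE mem_set // mule1 big1 ?adde0 //.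
  move=> a ac; rewrite indicE memNset ?mule0 //= => cx.
  by move: ac; rewrite cx eqxx.
rewrite ge0_integral_sum //.
- rewrite big_enum -sumEFin; apply: eq_bigr => a _.
  rewrite ge0_integralZl_EFin //.
  + rewrite integral_indic // setIT mulrC EFinM; congr (_ * _)%E.
    exact: cell_weightE.
  + by apply/measurable_EFinP; exact: measurable_indic.
- move=> a; apply: measurable_funeM; apply/measurable_EFinP; exact: measurable_indic.
- by move=> a x _; rewrite mule_ge0 // lee_fin.
Qed.

Lemma cell_weight_sum : \sum_a cell_weight a = 1.
Proof.
have := integral_step (fun=> ler01); under eq_bigr do rewrite mulr1.
rewrite [X in X = _ -> _](_ : _ = 1%:E) => [[]//|].
by rewrite integral_cst // mul1e; exact: probability_setT.
Qed.

Lemma ge0_le_integral_nonmeasurable (f g : T -> \bar R) :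
  (forall x, 0 <= f x)%E -> (forall x, f x <= g x)%E ->
  (\int[P]_x f x <= \int[P]_x g x)%E.
Proof.
move=> f0 fg; have g0 x : (0 <= g x)%E by exact: le_trans (fg x).
rewrite !ge0_integralTE //; apply: le_ereal_sup => _ [h hf <-].
by exists h => // x; exact: le_trans (hf x) (fg x).
Qed.

(** The integral of a nonnegative function is a supremum over the simple functions
    below it, so that comparison with step functions applies to every [F]. *)
Lemma integral_cells (F : T -> R) (H : J -> R) (eps : R) :
  0 <= eps -> (forall x, 0 <= F x) -> (forall a, 0 <= H a) ->
  (forall x, `|F x - H (c x)| <= eps) ->
  exists2 r : R, (\int[P]_x (F x)%:E)%E = r%:E &
    `|r - \sum_a cell_weight a * H a| <= eps.
Proof.
move=> eps0 F0 H0 FH.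
have up : (\int[P]_x (F x)%:E <= (\sum_a cell_weight a * (H a + eps))%:E)%E.
  rewrite -(@integral_step (fun a => H a + eps)); last by move=> a; rewrite addr_ge0.
  apply: ge0_le_integral_nonmeasurable => x; first by rewrite lee_fin.
  by rewrite lee_fin; have := FH x; rewrite ler_norml => /andP[_]; lra.
have lo : ((\sum_a cell_weight a * Num.max (H a - eps) 0)%:E <= \int[P]_x (F x)%:E)%E.
  rewrite -(@integral_step (fun a => Num.max (H a - eps) 0)); last first.
    by move=> a; rewrite le_max lexx orbT.
  apply: ge0_le_integral_nonmeasurable => x; rewrite lee_fin.
    by rewrite le_max lexx orbT.
  by rewrite ge_max F0 andbT; have := FH x; rewrite ler_norml => /andP[]; lra.
have fin : (\int[P]_x (F x)%:E)%E \is a fin_num.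
  rewrite ge0_fin_numE; first by apply: le_lt_trans up _; rewrite ltry.
  by apply: integral_ge0 => x _; rewrite lee_fin.
exists (fine (\int[P]_x (F x)%:E)); first by rewrite fineK.
move: up lo; rewrite -(fineK fin) !lee_fin; set r := fine _ => up lo.
have e1 : \sum_a cell_weight a * eps = eps by rewrite -mulr_suml cell_weight_sum mul1r.
have e2 : \sum_a cell_weight a * (H a - eps) = \sum_a cell_weight a * H a - eps.
  by rewrite -[in RHS]e1 -sumrB; apply: eq_bigr => a _; rewrite mulrBr.
have e3 : \sum_a cell_weight a * (H a + eps) = \sum_a cell_weight a * H a + eps.
  by rewrite -[in RHS]e1 -big_split; apply: eq_bigr => a _; rewrite mulrDr.
have : \sum_a cell_weight a * (H a - eps) <= r.
  apply: le_trans lo; apply: ler_sum => a _; apply: ler_wpM2l.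
    exact: cell_weight_ge0.
  by rewrite le_max lexx.
move: up; rewrite e2 e3 /= ler_norml => up lo'; apply/andP; split; lra.
Qed.

End IntegralCells.

(** * Power functions *)

Lemma bernoulli_powR (R : realType) (r y : R) : 1 <= r -> 0 <= y ->
  1 + r * (y - 1) <= y `^ r.
Proof.
move=> r1 y0; have [->|r1'] := eqVneq r 1; first by rewrite powRr1 //; lra.
have r2 : 1 < r by rewrite lt_neqAle eq_sym r1'.
have r0 : 0 < r by lra.
have rr : 0 < 1 - r^-1 by rewrite subr_gt0 invf_lt1.
have := @conjugate_powR R y 1 r (1 - r^-1)^-1 y0 ler01 r0.
rewrite invr_gt0 => /(_ rr); rewrite !invrK addrC subrK => /(_ erefl).
rewrite powR1 mulr1 mul1r => h.
have : r * y <= r * (y `^ r / r + (1 - r^-1)) by rewrite ler_pM2l.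
have -> : r * (y `^ r / r + (1 - r^-1)) = y `^ r + r - 1 by field; rewrite gt_eqF.
lra.
Qed.

Lemma powR_lipschitz (R : realType) (p S x y : R) : 1 <= p ->
  0 <= x <= S -> 0 <= y <= S -> `|x `^ p - y `^ p| <= p * S `^ (p - 1) * `|x - y|.
Proof.
move=> p1; wlog yx : x y / y <= x.
  move=> wl hx hy; case: (leP y x) => [yx|/ltW xy]; first exact: wl.
  by rewrite distrC [X in _ * X]distrC; exact: wl.
move=> /andP[x0 xS] /andP[y0 yS]; have p0 : 0 < p by lra.
rewrite !ger0_norm ?subr_ge0 //; last first.
  by apply: ge0_ler_powR; rewrite ?nnegrE //; lra.
have Sp0 := powR_ge0 S (p - 1).
have [xe|xn0] := eqVneq x 0.
  have -> : y = x by lra.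
  by rewrite !subrr mulr0.
have xp : 0 < x by rewrite lt0r xn0.
apply: (@le_trans _ _ (p * x `^ (p - 1) * (x - y))); last first.
  apply: ler_wpM2r; first lra.
  by rewrite ler_pM2l //; apply: ge0_ler_powR; rewrite ?nnegrE //; lra.
have q0 : 0 <= y / x by rewrite divr_ge0.
have := ler_wpM2l (powR_ge0 x p) (bernoulli_powR p1 q0).
rewrite -powRM // [x * _]mulrC divfK // => h.
have e : x `^ p * (1 + p * (y / x - 1)) = x `^ p - p * x `^ (p - 1) * (x - y).
  by rewrite -(mulr_powRB1 (ltW xp) p0); field.
move: h; rewrite e; lra.
Qed.

(** * Discretization of one factor *)

Lemma lp_norm_powE (R : realType) (k : scalar_kind) d (T : measurableType d)
    (mu : probability T R) (p : R) (f : T -> scalar_field R k) : p != 0 ->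
  (lp_norm mu p f `^ p = \int[mu]_x ((modulus (f x)) `^ p)%:E)%E.
Proof.
move=> p0; rewrite /lp_norm poweR_Lnorm //; apply: eq_integral => x _ /=.
by rewrite ger0_norm ?modulus_ge0.
Qed.

Lemma lp_normE (R : realType) (k : scalar_kind) d (T : measurableType d)
    (mu : probability T R) (p a : R) (f : T -> scalar_field R k) :
  (\int[mu]_x ((modulus (f x)) `^ p)%:E)%E = a%:E ->
  lp_norm mu p f = (a `^ p^-1)%:E.
Proof.
move=> e; rewrite /lp_norm unlock /Lnorm -poweR_EFin -e; congr (poweR _ _).
apply: eq_integral => x _ /=.
by rewrite ger0_norm ?modulus_ge0.
Qed.

Lemma modulus_le_uniform_norm (R : realType) (k : scalar_kind) (T : Type)
    (f : T -> scalar_field R k) x : ((modulus (f x))%:E <= uniform_norm f)%E.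
Proof. by apply: ereal_sup_ubound; exists x. Qed.

Section CellRepresentatives.
Context (T : pointedType) (J : Type) (c : T -> J).

Definition cell_point (a : J) : T := get (c @^-1` [set a]).

Lemma cell_pointP x : c (cell_point (c x)) = c x.
Proof. by have /getPex := ex_intro (c @^-1` [set c x]) x erefl. Qed.

End CellRepresentatives.

Section OneFunction.
Context (R : realType) (k : scalar_kind) (A : compact_domain R).
Context (mu : probability (borel (points A)) R).
Context (f : points A -> scalar_field R k).
Hypothesis f_cont : continuous f.

Lemma integral_power_approx (p q eps : R) : 1 <= p -> 1 <= q -> 0 < eps ->
  exists (J : finType) (w H : J -> R), exists a b : R,
  [/\ forall i, 0 <= w i, \sum_i w i = 1, forall i, 0 <= H i,
      (\int[mu]_x ((modulus (f x)) `^ p)%:E)%E = a%:E /\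
      `|a - \sum_i w i * H i `^ p| <= eps &
      (\int[mu]_x ((modulus (f x)) `^ q)%:E)%E = b%:E /\
      `|b - \sum_i w i * H i `^ q| <= eps].
Proof.
move=> p1 q1 eps0.
have [S SP] := continuous_modulus_bounded f_cont.
pose L r := r * S `^ (r - 1).
have Lp : 0 <= L p by rewrite mulr_ge0 ?powR_ge0 //; lra.
have Lq : 0 <= L q by rewrite mulr_ge0 ?powR_ge0 //; lra.
pose d := eps / (L p + L q + 1).
have D0 : 0 < L p + L q + 1 by lra.
have d0 : 0 < d by rewrite divr_gt0.
have [J [c [c_meas osc]]] := measurable_cells (n := 1) (fun=> f_cont) d0.
have lip r : 1 <= r -> L r <= L p + L q + 1 -> forall x,
    `|modulus (f x) `^ r - modulus (f (cell_point c (c x))) `^ r| <= eps.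
  move=> r1 rL x.
  apply: le_trans (powR_lipschitz (S := S) r1 _ _) _; rewrite ?modulus_ge0 ?SP //.
  apply: (@le_trans _ _ (L r * d)).
    apply: ler_wpM2l; first by rewrite mulr_ge0 ?powR_ge0 //; lra.
    apply: le_trans (modulusB_lip _ _) _; apply: (osc ord0).
    by rewrite cell_pointP.
  by rewrite /d mulrA ler_pdivrMr // mulrC ler_pM2l.
pose H a := modulus (f (cell_point c a)).
have [|||a aE aP] := @integral_cells _ _ R mu J c c_meas
    (fun x => modulus (f x) `^ p) (fun i => H i `^ p) eps (ltW eps0) _ _ (lip p p1 _).
- by move=> x; exact: powR_ge0.
- by move=> x; exact: powR_ge0.
- lra.
have [|||b bE bP] := @integral_cells _ _ R mu J c c_meas
    (fun x => modulus (f x) `^ q) (fun i => H i `^ q) eps (ltW eps0) _ _ (lip q q1 _).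
- by move=> x; exact: powR_ge0.
- by move=> x; exact: powR_ge0.
- lra.
exists J, (cell_weight mu c), H, a, b; split => //.
- by move=> i; exact: cell_weight_ge0.
- exact: cell_weight_sum.
- by move=> i; exact: modulus_ge0.
Qed.

(** Monotonicity of the norms of a probability space in the exponent: the tangent
    of [y |-> y ^ (p / q)] at the mean of [|f|^q] is averaged over cells. *)
Lemma integral_power_jensen (p q : R) : 1 <= q -> q <= p -> exists a b : R,
  [/\ (\int[mu]_x ((modulus (f x)) `^ p)%:E)%E = a%:E,
      (\int[mu]_x ((modulus (f x)) `^ q)%:E)%E = b%:E, 0 <= a, 0 <= b &
      b `^ (p / q) <= a].
Proof.
move=> q1 qp; have p1 : 1 <= p by lra.
have [_ [_ [_ [a [b [_ _ _ [aE _] [bE _]]]]]]] := integral_power_approx p1 q1 ltr01.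
have a0 : 0 <= a.
  by rewrite -lee_fin -aE; apply: integral_ge0 => x _; rewrite lee_fin powR_ge0.
have b0 : 0 <= b.
  by rewrite -lee_fin -bE; apply: integral_ge0 => x _; rewrite lee_fin powR_ge0.
exists a, b; split => //.
have r1 : 1 <= p / q by rewrite ler_pdivlMr; lra.
have [->|bn0] := eqVneq b 0; first by rewrite powR0 //; lra.
have bp : 0 < b by rewrite lt0r bn0.
pose D := b `^ (p / q) * (p / q) / b.
have r0 : 0 <= p / q by lra.
have D0 : 0 <= D.
  by apply: divr_ge0 => //; apply: mulr_ge0 => //; exact: powR_ge0.
apply/ler_addgt0Pr => e e0.
have e1 : 0 < e / (1 + D) by rewrite divr_gt0 //; lra.
have [J [w [H [a' [b' [w0 w1 H0 [a'E aP] [b'E bP]]]]]]] :=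
  integral_power_approx p1 q1 e1.
have aa : a' = a by have := aE; rewrite a'E => -[].
have bb : b' = b by have := bE; rewrite b'E => -[].
rewrite {}aa in aP; rewrite {}bb in bP.
have tangent : b `^ (p / q) * (1 + p / q * ((\sum_i w i * H i `^ q) / b - 1)) <=
    \sum_i w i * H i `^ p.
  have -> : b `^ (p / q) * (1 + p / q * ((\sum_i w i * H i `^ q) / b - 1)) =
      \sum_i w i * (b `^ (p / q) * (1 + p / q * (H i `^ q / b - 1))).
    have -> : (\sum_i w i * H i `^ q) / b = \sum_i w i * (H i `^ q / b).
      by rewrite mulr_suml; apply: eq_bigr => i _; rewrite mulrA.
    rewrite -[X in 1 + _ * (_ - X)]w1 -sumrB mulr_sumr -[X in X + _]w1 -big_split.
    rewrite mulr_sumr; apply: eq_bigr => i _ /=; ring.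
  apply: ler_sum => i _; apply: ler_wpM2l => //.
  have -> : H i `^ p = (H i `^ q) `^ (p / q).
    by rewrite -powRrM mulrC divfK // gt_eqF //; lra.
  have z0 : 0 <= H i `^ q / b by rewrite divr_ge0 ?powR_ge0.
  apply: le_trans (ler_wpM2l (powR_ge0 b _) (bernoulli_powR r1 z0)) _.
  by rewrite -powRM // mulrC divfK.
set SP := \sum_i w i * H i `^ p in aP tangent.
set SQ := \sum_i w i * H i `^ q in bP tangent.
move: aP bP; rewrite !ler_norml => /andP[aP1 aP2] /andP[bP1 bP2].
have eqD : b `^ (p / q) * (1 + p / q * (SQ / b - 1)) = b `^ (p / q) + D * (SQ - b).
  by rewrite /D; field; rewrite gt_eqF //=; lra.
rewrite eqD in tangent.
have : D * (- (e / (1 + D))) <= D * (SQ - b) by apply: ler_wpM2l => //; lra.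
have : e / (1 + D) + D * (e / (1 + D)) = e by field; lra.
lra.
Qed.

Lemma nikolskii_power (p q K : R) : 1 <= q -> q <= p -> 0 <= K ->
  (uniform_norm f <= K%:E * lp_norm mu q f)%E ->
  exists a : R, [/\ (\int[mu]_x ((modulus (f x)) `^ p)%:E)%E = a%:E, 0 <= a &
    forall x, modulus (f x) `^ p <= K `^ p * a].
Proof.
move=> q1 qp K0 nik.
have [a [b [aE bE a0 b0 ab]]] := integral_power_jensen q1 qp.
exists a; split => // x.
have fx : modulus (f x) <= K * b `^ q^-1.
  have := le_trans (modulus_le_uniform_norm f x) nik.
  by rewrite (lp_normE bE) -EFinM lee_fin.
apply: (@le_trans _ _ ((K * b `^ q^-1) `^ p)).
  by apply: ge0_ler_powR; rewrite ?nnegrE ?modulus_ge0 ?mulr_ge0 ?powR_ge0 //; lra.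
rewrite powRM ?powR_ge0 // -powRrM mulrC [q^-1 * p]mulrC.
by rewrite mulrC; apply: ler_wpM2l; rewrite ?powR_ge0.
Qed.

End OneFunction.

Section OneFactor.
Context (R : realType) (k : scalar_kind) (A : compact_domain R).
Context (mu : probability (borel (points A)) R) (p M : R).
Context (n : nat) (e : 'I_n -> points A -> scalar_field R k).
Hypothesis p1 : 1 <= p.
Hypothesis M1 : 1 <= M.
Hypothesis e_ind : lin_indep e.
Hypothesis e_cont : forall f, span_of (range e) f -> continuous f.
Hypothesis nik : forall f, span_of (range e) f ->
  exists a : R, [/\ (\int[mu]_x ((modulus (f x)) `^ p)%:E)%E = a%:E, 0 <= a &
    forall x, modulus (f x) `^ p <= M * a].

Definition power_mean (f : points A -> scalar_field R k) : R :=
  fine (\int[mu]_x ((modulus (f x)) `^ p)%:E)%E.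

(** Coefficients are controlled by the values at unisolvent points, so all the
    functions of the space oscillate little, relative to their size, on cells on
    which the basis does. *)
Lemma uniform_cells (eta : R) : 0 < eta ->
  exists (J : finType) (c : borel (points A) -> J),
  [/\ forall a, measurable (c @^-1` [set a]),
      forall f S, span_of (range e) f -> (forall x, modulus (f x) <= S) ->
        forall x y, c x = c y -> modulus (f x - f y) <= eta * S &
      forall f, span_of (range e) f ->
        `|power_mean f - mean_power (cell_weight mu c) p (f \o cell_point c)|
        <= eta * power_mean f].
Proof.
move=> eta0.
have [y yP] := unisolvent_points e_ind.
have [la [laP [la_span _]]] := interpolation yP.
pose eta' := Num.min eta (eta / (p * M)).
have p0 : 0 < p by exact: lt_le_trans p1.
have M0 : 0 < M by exact: lt_le_trans M1.
have pM0 : 0 < p * M by exact: mulr_gt0.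
have eta'0 : 0 < eta' by rewrite lt_min eta0 divr_gt0.
have d0 : 0 < eta' / n.+1%:R by rewrite divr_gt0.
have [J [c [c_meas osc]]] := measurable_cells (fun l => e_cont (la_span l)) d0.
have osc_f f S : span_of (range e) f -> (forall x, modulus (f x) <= S) ->
    forall x x', c x = c x' -> modulus (f x - f x') <= eta' * S.
  move=> /span_of_range[b fE] fS x x' cxx'.
  have S0 : 0 <= S by apply: le_trans (fS x); exact: modulus_ge0.
  have fla z : f z = \sum_i f (y i) * la i z by rewrite {1}fE laP fE.
  rewrite (fla x) (fla x') -sumrB; apply: le_trans (modulus_sum _ _ _) _.
  apply: (@le_trans _ _ (\sum_(i < n) S * (eta' / n.+1%:R))).
    apply: ler_sum => i _; rewrite -mulrBr modulusM.
    by apply: ler_pM; rewrite ?modulus_ge0 ?fS ?osc.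
  rewrite sumr_const card_ord -[_ *+ n]mulr_natr.
  have -> : S * (eta' / n.+1%:R) * n%:R = eta' * S * (n%:R / n.+1%:R) by ring.
  rewrite -[leRHS]mulr1; apply: ler_wpM2l; first by rewrite mulr_ge0 // ltW.
  by rewrite ler_pdivrMr // mul1r ler_nat.
exists J, c; split => //.
  move=> f S fs fS x x' cxx'; apply: le_trans (osc_f f S fs fS x x' cxx') _.
  apply: ler_wpM2r; last by rewrite ge_min lexx.
  by apply: le_trans (fS x); exact: modulus_ge0.
move=> f fs; have [a [aE a0 aM]] := nik fs.
pose S := (M * a) `^ p^-1.
have Ma0 : 0 <= M * a by rewrite mulr_ge0 // ltW.
have SpE : S `^ p = M * a by rewrite /S -powRrM mulVf ?gt_eqF // powRr1.
have fS x : modulus (f x) <= S.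
  rewrite -[leLHS]powRr1 ?modulus_ge0 // -(@mulfV _ p) ?gt_eqF // powRrM.
  apply: ge0_ler_powR; rewrite ?nnegrE ?powR_ge0 ?invr_ge0 //; exact: ltW.
have S0 : 0 <= S by exact: powR_ge0.
have [|||x|b bE bP] := @integral_cells _ _ R mu J c c_meas
    (fun x => modulus (f x) `^ p) (fun i => modulus (f (cell_point c i)) `^ p)
    (eta * a) _ _ _ _.
- by rewrite mulr_ge0 // ltW.
- by move=> x; exact: powR_ge0.
- by move=> x; exact: powR_ge0.
- apply: le_trans (powR_lipschitz (S := S) p1 _ _) _; rewrite ?modulus_ge0 ?fS //.
  apply: (@le_trans _ _ (p * S `^ (p - 1) * (eta' * S))).
    apply: ler_wpM2l; first by rewrite mulr_ge0 ?powR_ge0 // ltW.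
    apply: le_trans (modulusB_lip _ _) _; apply: osc_f => //.
    by rewrite cell_pointP.
  have -> : p * S `^ (p - 1) * (eta' * S) = eta' * (p * M) * a.
    rewrite -[eta' * (p * M) * a]mulrA -[p * M * a]mulrA -SpE -(mulr_powRB1 S0 p0); ring.
  apply: ler_wpM2r => //; rewrite -ler_pdivlMr //.
  by rewrite ge_min lexx orbT.
have ab : b = a by have := aE; rewrite bE => -[].
by rewrite /power_mean aE /=; rewrite ab in bP.
Qed.

End OneFactor.

(** The bound by the [q]-norm becomes one by the [p]-th power mean, in which [q]
    appears in the constant alone. *)
Lemma factor_nikolskii (R : realType) (k : scalar_kind) (A : compact_domain R)
    (mu : probability (borel (points A)) R) (p q B : R) (n : nat)
    (f : points A -> scalar_field R k) :
  1 <= q -> q <= p -> 0 <= B -> continuous f ->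
  (uniform_norm f <= (B * n%:R `^ q^-1)%:E * lp_norm mu q f)%E ->
  exists a : R, [/\ (\int[mu]_x ((modulus (f x)) `^ p)%:E)%E = a%:E, 0 <= a &
    forall x, modulus (f x) `^ p <= B `^ p * n%:R `^ (p / q) * a].
Proof.
move=> q1 qp B0 f_cont nik.
have K0 : 0 <= B * n%:R `^ q^-1 by rewrite mulr_ge0 ?powR_ge0.
have [a [aE a0 aP]] := nikolskii_power f_cont q1 qp K0 nik.
exists a; split => // x; apply: le_trans (aP x) _.
by rewrite powRM ?powR_ge0 // -?powRrM 1?[q^-1 * p]mulrC.
Qed.

Lemma le_log2 (R : realType) (p q B : R) (n : nat) :
  1 <= q -> q <= p -> 1 <= B -> (0 < n)%N ->
  1 + ln (B `^ p * n%:R `^ (p / q)) <= (1 + p) * log2 (2 * B * n%:R).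
Proof.
move=> q1 qp B1 n_gt0.
have n1 : (1 : R) <= n%:R by rewrite ler1n.
have B0 : 0 < B by lra.
have n0' : (0 : R) < n%:R by lra.
have ln2 : 0 < ln (2 : R) by apply: ln_gt0; lra.
have ln21 : ln (2 : R) <= 1 by apply: le_trans (le_ln1Dx _) _; lra.
have lnB : 0 <= ln B by exact: ln_ge0.
have lnn : 0 <= ln (n%:R : R) by exact: ln_ge0.
set l := log2 _.
have lE : l = 1 + (ln B + ln n%:R) / ln 2.
  by rewrite /l /log2 !lnM ?posrE ?mulr_gt0 //; field; rewrite gt_eqF.
have l_ge : 1 + (ln B + ln n%:R) <= l.
  rewrite lE lerD2l ler_pdivlMr // ler_piMr //; lra.
rewrite lnM ?posrE ?powR_gt0 // !ln_powR.
have : p / q * ln n%:R <= p * ln n%:R.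
  apply: ler_wpM2r => //; rewrite ler_pdivrMr ?ler_peMr //; lra.
have : p * (1 + (ln B + ln n%:R)) <= p * l by rewrite ler_pM2l //; lra.
by rewrite mulrDl; lra.
Qed.

(** Discretize the measure of the cells, on which the basis remains independent
    because the cell means are comparable with the integrals. *)
Theorem factor_discretization (R : realType) (p : R) :
  2 <= p -> exists2 C : R, 0 < C &
  forall (k : scalar_kind) (A : compact_domain R)
    (mu : probability (borel (points A)) R) (n : nat) (M : R)
    (e : 'I_n -> points A -> scalar_field R k),
  (0 < n)%N -> 1 <= M -> n%:R <= M -> lin_indep e ->
  (forall f, span_of (range e) f -> continuous f) ->
  (forall f, span_of (range e) f ->
    exists a : R, [/\ (\int[mu]_x ((modulus (f x)) `^ p)%:E)%E = a%:E, 0 <= a &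
    forall x, modulus (f x) `^ p <= M * a]) ->
  exists (m : nat) (xi : 'I_m -> points A), [/\ (0 < m)%N,
    m%:R <= C * M * (1 + ln M) ^+ 3 &
    forall f, span_of (range e) f ->
      3 / 4 * power_mean mu p f <= (\sum_j modulus (f (xi j)) `^ p) / m%:R <=
      4 / 3 * power_mean mu p f].
Proof.
move=> p2; have p1 : 1 <= p by lra.
have [C C0 CP] := finite_discretization p2.
exists (16 * C); first by rewrite mulr_gt0.
move=> k A mu n M e n0 M1 nM e_ind e_cont nik'.
have eta0 : 0 < 1 / 50 :> R by lra.
have [J [c [c_meas _ cP]]] := uniform_cells p1 M1 e_ind e_cont nik' eta0.
pose w := cell_weight mu c.
have w0 j : 0 <= w j by exact: cell_weight_ge0.
have w1 : \sum_j w j = 1 by exact: cell_weight_sum.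
pose e' l j := e l (cell_point c j).
have mean0 f : span_of (range e) f -> 0 <= power_mean mu p f.
  by move=> /nik'[a [aE a0 _]]; rewrite /power_mean aE.
have close f : span_of (range e) f ->
    49 / 50 * power_mean mu p f <= mean_power w p (f \o cell_point c) <=
    51 / 50 * power_mean mu p f.
  move=> /cP; rewrite ler_norml => /andP[h1 h2]; apply/andP; split; lra.
have lift f : span_of (range e') f -> exists2 h, span_of (range e) h &
    f = h \o cell_point c.
  move=> /span_of_range[b ->]; exists (fun x => \sum_l b l * e l x) => //.
  by exists n, b, e; split => // l; exists l.
have e'_ind : lin_indep e'.
  move=> b b0; apply: e_ind => x.
  pose f x := \sum_l b l * e l x.
  have fs : span_of (range e) f by exists n, b, e; split => // l; exists l.
  have f0 : mean_power w p (f \o cell_point c) = 0.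
    apply: big1 => j _; rewrite (_ : (f \o cell_point c) j = 0); last exact: (b0 j).
    by rewrite modulus0 powR0 ?mulr0 // gt_eqF //; lra.
  have m0 : power_mean mu p f = 0.
    have := close f fs; rewrite f0 => /andP[h1 _].
    by have := mean0 f fs; lra.
  have [a [aE _ aP]] := nik' f fs.
  have a0 : a = 0 by move: m0; rewrite /power_mean aE.
  apply: (@modulus_eq0 R k); apply/eqP; rewrite eq_le modulus_ge0 andbT.
  have /powR_eq0_eq0 -> // : modulus (f x) `^ p = 0.
  by apply/eqP; rewrite eq_le powR_ge0 andbT (le_trans (aP x)) // a0 mulr0.
have [||f j fs|m [z [m0 mM zP]]] := CP k J w n e' (2 * M) w0 w1 e'_ind n0.
- lra.
- lra.
- have [h hs ->] := lift f fs; have [a [aE a0 aP]] := nik' h hs.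
  have /andP[h1 _] := close h hs; move: h1; rewrite /power_mean aE /= => h1.
  apply: le_trans (aP _) _; rewrite -mulrA mulrCA ler_pM2l; lra.
exists m, (fun j => cell_point c (z j)); split => //.
  apply: le_trans mM _.
  have M0 : 0 < M by lra.
  have l0 : 0 <= ln M by rewrite ln_ge0.
  have l2 : ln (2 : R) <= 1 by apply: le_trans (le_ln1Dx _) _; lra.
  have l2' : 0 <= ln (2 : R) by rewrite ln_ge0 // ler1n.
  have lM : 1 + ln (2 * M) <= 2 * (1 + ln M) by rewrite lnM ?posrE //; lra.
  have -> : 16 * C * M * (1 + ln M) ^+ 3 = C * (2 * M) * (2 * (1 + ln M)) ^+ 3 by ring.
  apply: ler_wpM2l; first by rewrite !mulr_ge0 // ltW.
  apply: lerXn2r => //; rewrite nnegrE; last lra.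
  rewrite lnM ?posrE //; lra.
move=> f fs.
have fs' : span_of (range e') (f \o cell_point c).
  have [b fE] := span_of_range fs; exists n, b, e'; split; first by move=> l; exists l.
  by rewrite fE.
have m0' : (0 : R) < m%:R by rewrite ltr0n.
have /andP[h1 h2] := close f fs; have := zP _ fs'; rewrite /= => /andP[h3 h4].
have := mean0 f fs; rewrite ler_pdivlMr // ler_pdivrMr //.
move: h3 h4; set Q := mean_power _ _ _ in h1 h2 *; set I := power_mean _ _ _ in h1 h2 *.
move=> h3 h4 I0; apply/andP; split.
  apply: le_trans h3; rewrite ler_pM2r //; lra.
apply: le_trans h4 _; rewrite ler_pM2r //; lra.
Qed.

(** * Products of finite weighted families *)

Section Hybrid.
Context (R : realType) (s : nat) (J : 'I_s -> finType).
Local Notation pt := {dffun forall i, J i}.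

Definition update (a : pt) (i : 'I_s) (b : J i) : pt := [ffun j => dfwith a i b j].

Lemma update_in (a : pt) i (b : J i) : update a b i = b.
Proof. by rewrite ffunE dfwithin. Qed.

Lemma update_out (a : pt) i (b : J i) j : i != j -> update a b j = a j.
Proof. by move=> ij; rewrite ffunE dfwithout. Qed.

Lemma update_back (a : pt) i (b : J i) : update (update a b) (a i) = a.
Proof.
apply/ffunP => j; have [<-|ij] := eqVneq i j; first by rewrite update_in.
by rewrite !update_out.
Qed.

(** Integrating out one coordinate first. Summing also over the discarded value
    of the coordinate only multiplies the sum by a constant, and it makes the
    change of variables an involution. *)
Lemma sum_coordinate (g : forall i, J i -> R) (G : pt -> R) i0 :
  \sum_(a : pt) (\prod_(i | i != i0) g i (a i)) *
    (\sum_b g i0 b * G (update a b)) =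
  #|J i0|%:R * \sum_(a : pt) (\prod_i g i (a i)) * G a.
Proof.
pose phi (a : pt) := (\prod_i g i (a i)) * G a.
transitivity (\sum_(x : pt * J i0) phi (update x.1 x.2)).
  rewrite -(pair_big xpredT xpredT (fun a b => phi (update a b))) /=.
  apply: eq_bigr => a _; rewrite mulr_sumr; apply: eq_bigr => b _.
  rewrite /phi [in RHS](bigD1 i0) // update_in /= mulrA [g i0 b * _]mulrC; congr (_ * _ * _).
  by apply: eq_bigr => i ii0; rewrite update_out // eq_sym.
rewrite (reindex_inj (h := fun x : pt * J i0 => (update x.1 x.2, x.1 i0))) /=; last first.
  by apply: inv_inj => -[a b] /=; rewrite update_back update_in.
under eq_bigr do rewrite update_back.
rewrite -(pair_big xpredT xpredT (fun a b => phi a)) /= mulr_sumr.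
by apply: eq_bigr => a _; rewrite sumr_const -[LHS]mulr_natl.
Qed.

(** A telescoping product over hybrid weights, which are [be] in the coordinates
    below [t] and [al] in the others. *)
Lemma hybrid_le (al be : forall i, J i -> R) (G : pt -> R) (kappa : R) :
  0 <= kappa -> (forall i b, 0 <= al i b) -> (forall i b, 0 <= be i b) ->
  (forall (a : pt) i, kappa * (\sum_b al i b * G (update a b)) <=
     \sum_b be i b * G (update a b)) ->
  kappa ^+ s * (\sum_(a : pt) (\prod_i al i (a i)) * G a) <=
  \sum_(a : pt) (\prod_i be i (a i)) * G a.
Proof.
move=> kappa0 al0 be0 one.
pose ga t i : J i -> R := if (i < t)%N then be i else al i.
have ga0 t i b : 0 <= ga t i b by rewrite /ga; case: ifP.
pose H t := \sum_(a : pt) (\prod_i ga t i (a i)) * G a.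
have step (t : 'I_s) : kappa * H t <= H t.+1.
  have [J0|J0] := posnP #|J t|.
    have none (a : pt) : False.
      by have := fintype0 (a t); rewrite J0.
    by rewrite /H !big1 ?mulr0 // => a; case: (none a).
  have cJ : 0 < #|J t|%:R :> R by rewrite ltr0n.
  rewrite -(ler_pM2l cJ) mulrCA -!sum_coordinate mulr_sumr; apply: ler_sum => a _.
  have -> : \prod_(i | i != t) ga t.+1 i (a i) = \prod_(i | i != t) ga t i (a i).
    apply: eq_bigr => i it; rewrite /ga ltnS leq_eqVlt.
    by rewrite (negbTE it : (i == t :> nat) = false).
  rewrite mulrCA; apply: ler_wpM2l; first by apply: prodr_ge0 => i _.
  by rewrite /ga ltnn leqnn; exact: one.
have -> : \sum_(a : pt) (\prod_i al i (a i)) * G a = H 0%N by [].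
have -> : \sum_(a : pt) (\prod_i be i (a i)) * G a = H s.
  by apply: eq_bigr => a _; congr (_ * _); apply: eq_bigr => i _; rewrite /ga ltn_ord.
have : forall t, (t <= s)%N -> kappa ^+ t * H 0%N <= H t.
  elim=> [|t IH] ts; first by rewrite mul1r.
  rewrite exprS -mulrA; apply: le_trans (step (Ordinal ts)).
  by apply: ler_wpM2l => //; apply: IH; exact: ltnW.
exact.
Qed.

Lemma sum_support (K : 'I_s -> finType) (io : forall i, K i -> J i)
    (ro : forall i, J i -> K i) (g : forall i, J i -> R) (G : pt -> R) :
  (forall i, cancel (io i) (ro i)) ->
  (forall i b, io i (ro i b) != b -> g i b = 0) ->
  \sum_(a : pt) (\prod_i g i (a i)) * G a =
  \sum_(j : {dffun forall i, K i})
    (\prod_i g i (io i (j i))) * G [ffun i => io i (j i)].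
Proof.
move=> ioK g0.
pose h (j : {dffun forall i, K i}) : pt := [ffun i => io i (j i)].
pose h' (a : pt) : {dffun forall i, K i} := [ffun i => ro i (a i)].
rewrite (bigID (fun a => h (h' a) == a)) /= [X in _ + X]big1 ?addr0; last first.
  move=> a ha; have [i ia] : exists i, io i (ro i (a i)) != a i.
    apply/existsP; apply: contraR ha; rewrite negb_exists => /forallP all.
    apply/eqP/ffunP => i; rewrite !ffunE; exact/eqP/negPn/all.
  by rewrite (bigD1 i) //= g0 ?mul0r.
rewrite (reindex_onto h h') /=; last by move=> a /eqP.
have hK j : h' (h j) = j by apply/ffunP => i; rewrite !ffunE ioK.
apply: eq_big => [j|j _]; first by rewrite hK !eqxx.
by congr (_ * _); apply: eq_bigr => i _; rewrite ffunE.
Qed.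

End Hybrid.

Lemma modulus_prod_le (R : realType) (k : scalar_kind) (I : Type) (r : seq I)
    (a : I -> scalar_field R k) (S : R) : 1 <= S ->
  (forall i, modulus (a i) <= S) -> modulus (\prod_(i <- r) a i) <= S ^+ size r.
Proof.
move=> S1 aS; elim: r => [|i r IH]; first by rewrite big_nil modulus1.
by rewrite big_cons modulusM exprS ler_pM ?modulus_ge0.
Qed.

Lemma modulus_prod_lip (R : realType) (k : scalar_kind) (I : Type) (r : seq I)
    (a b : I -> scalar_field R k) (S d : R) : 1 <= S -> 0 <= d ->
  (forall i, modulus (a i) <= S) -> (forall i, modulus (b i) <= S) ->
  (forall i, modulus (a i - b i) <= d) ->
  modulus (\prod_(i <- r) a i - \prod_(i <- r) b i) <=
  (size r)%:R * S ^+ size r * d.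
Proof.
move=> S1 d0 aS bS ab; elim: r => [|i r IH].
  by rewrite !big_nil subrr modulus0 !mul0r.
rewrite !big_cons.
have -> : a i * \prod_(j <- r) a j - b i * \prod_(j <- r) b j =
    a i * (\prod_(j <- r) a j - \prod_(j <- r) b j) + (a i - b i) * \prod_(j <- r) b j.
  by ring.
apply: le_trans (modulusD _ _) _; rewrite !modulusM /=.
have S0 : 0 <= S by lra.
have : modulus (a i) * modulus (\prod_(j <- r) a j - \prod_(j <- r) b j) <=
    S * ((size r)%:R * S ^+ size r * d).
  by apply: ler_pM; rewrite ?modulus_ge0.
have : modulus (a i - b i) * modulus (\prod_(j <- r) b j) <= d * S ^+ (size r).+1.
  apply: ler_pM; rewrite ?modulus_ge0 //; apply: le_trans (modulus_prod_le r S1 bS) _.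
  exact: ler_weXn2l.
rewrite exprS -natr1; lra.
Qed.

(** * Tensor products *)

Section ProductCells.
Context (R : realType) (s : nat) (Omega : 'I_s -> compact_domain R).
Context (mus : forall i, probability (borel (points (Omega i))) R).
Context (mu : probability (product_space (fun i => borel (points (Omega i)))) R).
Context (J : 'I_s -> finType) (c : forall i, borel (points (Omega i)) -> J i).
Hypothesis mu_prod : is_product_measure mus mu.
Hypothesis c_meas : forall i a, measurable (@c i @^-1` [set a]).
Local Notation pts := (product_space (fun i => borel (points (Omega i)))).

Definition product_cell (x : pts) : {dffun forall i, J i} := [ffun i => c (x i)].

Lemma product_cell_fiber (a : {dffun forall i, J i}) :
  product_cell @^-1` [set a] = box (fun i => @c i @^-1` [set a i]).
Proof.
apply/seteqP; split => [x /= <- i|x /= xa]; first by rewrite /= ffunE.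
by apply/ffunP => i; rewrite ffunE; exact: xa.
Qed.

Lemma measurable_product_cell a : measurable (product_cell @^-1` [set a]).
Proof.
rewrite product_cell_fiber; apply: sub_sigma_algebra.
by exists (fun i => @c i @^-1` [set a i]) => // i; exact: c_meas.
Qed.

Lemma product_cell_weight a :
  cell_weight mu product_cell a = \prod_i cell_weight (mus i) (@c i) (a i).
Proof.
rewrite /cell_weight product_cell_fiber mu_prod; last by move=> i; exact: c_meas.
have mE i : mus i (@c i @^-1` [set a i]) = (cell_weight (mus i) (@c i) (a i))%:E.
  by apply: cell_weightE; exact: c_meas.
rewrite (_ : (\prod_(i < s) mus i (@c i @^-1` [set a i]))%E =
  (\prod_i cell_weight (mus i) (@c i) (a i))%:E) //.
by rewrite -prodEFin; apply: eq_bigr => i _; exact: mE.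
Qed.

End ProductCells.

Section Tensor.
Context (R : realType) (k : scalar_kind) (p : R) (s : nat).
Context (Omega : 'I_s -> compact_domain R).
Context (mus : forall i, probability (borel (points (Omega i))) R).
Context (X : forall i, set (points (Omega i) -> scalar_field R k)).
Context (m : 'I_s -> nat) (xi : forall i, 'I_(m i) -> points (Omega i)).
Hypothesis m_gt0 : forall i, (0 < m i)%N.
Hypothesis xi_disc : forall i g, @X i g ->
  3 / 4 * power_mean (mus i) p g <= (\sum_j modulus (g (xi j)) `^ p) / (m i)%:R <=
  4 / 3 * power_mean (mus i) p g.

Definition grid_mean (f : (forall i, points (Omega i)) -> scalar_field R k) : R :=
  (\prod_(i < s) m i)%:R^-1 *
    \sum_(j : {dffun forall i : 'I_s, 'I_(m i)}) modulus (f (tensor_points xi j)) `^ p.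


Section Compare.
Context (J : 'I_s -> finType) (c : forall i, borel (points (Omega i)) -> J i).
Hypothesis c_close : forall i g, @X i g ->
  `|power_mean (mus i) p g -
    mean_power (cell_weight (mus i) (@c i)) p (g \o cell_point (@c i))| <=
  1 / 10 * power_mean (mus i) p g.
Context (f : (forall i, points (Omega i)) -> scalar_field R k).
Hypothesis f_slice : forall x i, @X i (fun t => f (dfwith x i t)).

Definition cell_mean : R := \sum_(a : {dffun forall i, J i})
  (\prod_i cell_weight (mus i) (@c i) (a i)) *
    modulus (f (fun i => cell_point (@c i) (a i))) `^ p.

(* Cells and grid points as indices of one family, so that both means are sums over
   the same product. *)
Let JJ i : finType := (J i + 'I_(m i))%type.
Let pt i (b : JJ i) : points (Omega i) :=
  match b with inl a => cell_point (@c i) a | inr j => xi j end.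
Let al i (b : JJ i) : R := if b is inl a then cell_weight (mus i) (@c i) a else 0.
Let be i (b : JJ i) : R := if b is inl _ then 0 else (m i)%:R^-1.
Let G (a : {dffun forall i, JJ i}) : R := modulus (f (fun i => pt (a i))) `^ p.

Let G_update a i (b : JJ i) :
  G (update a b) = modulus (f (dfwith (fun i => pt (a i)) i (pt b))) `^ p.
Proof.
rewrite /G; congr (modulus (f _) `^ p); apply: functional_extensionality_dep => j.
have [<-|ij] := eqVneq i j; first by rewrite update_in dfwithin.
by rewrite update_out // dfwithout.
Qed.

Let sum_al a i : \sum_(b : JJ i) al b * G (update a b) =
  mean_power (cell_weight (mus i) (@c i)) p
    ((fun t => f (dfwith (fun i => pt (a i)) i t)) \o cell_point (@c i)).
Proof.
rewrite big_sumType /= [X in _ + X]big1 ?addr0; last by move=> j _; rewrite mul0r.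
by apply: eq_bigr => b _; rewrite G_update.
Qed.

Let sum_be a i : \sum_(b : JJ i) be b * G (update a b) =
  (\sum_j modulus (f (dfwith (fun i => pt (a i)) i (xi j))) `^ p) / (m i)%:R.
Proof.
rewrite big_sumType /= big1 ?add0r; last by move=> j _; rewrite mul0r.
by rewrite mulr_suml; apply: eq_bigr => b _; rewrite G_update mulrC.
Qed.

Let al_ge0 i (b : JJ i) : 0 <= al b.
Proof. by case: b => //= a; exact: cell_weight_ge0. Qed.

Let be_ge0 i (b : JJ i) : 0 <= be b.
Proof. by case: b => //= a; rewrite invr_ge0. Qed.

Let cell_meanE : cell_mean = \sum_(a : {dffun forall i, JJ i}) (\prod_i al (a i)) * G a.
Proof.
pose ro i (b : JJ i) : J i := if b is inl a then a else c point.
rewrite (@sum_support R s JJ J (fun i => inl) ro al G) //; last first.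
  by move=> i [b|b] //=; rewrite eqxx.
apply: eq_bigr => a _; rewrite /G; congr (_ * modulus (f _) `^ p).
by apply: functional_extensionality_dep => i; rewrite ffunE.
Qed.

Let grid_meanE : grid_mean f = \sum_(a : {dffun forall i, JJ i}) (\prod_i be (a i)) * G a.
Proof.
pose ro i (b : JJ i) : 'I_(m i) := if b is inr a then a else Ordinal (m_gt0 i).
rewrite (@sum_support R s JJ (fun i => 'I_(m i)) (fun i => inr) ro be G) //; last first.
  by move=> i [b|b] //=; rewrite eqxx.
rewrite /grid_mean mulr_sumr; apply: eq_bigr => a _ /=; rewrite prodfV natr_prod.
rewrite /G; congr (_ * modulus (f _) `^ p).
by apply: functional_extensionality_dep => i; rewrite ffunE.
Qed.

(** In one coordinate both means are comparable with the integral of a section;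
    [3/4 / (1 + 1/10) >= 1/2] and [4/3 / (1 - 1/10) <= 3/2]. *)
Lemma grid_mean_cell_mean :
  (1 / 2) ^+ s * cell_mean <= grid_mean f <= (3 / 2) ^+ s * cell_mean.
Proof.
have one a i : 1 / 2 * (\sum_(b : JJ i) al b * G (update a b)) <= \sum_(b : JJ i) be b * G (update a b) <=
    3 / 2 * (\sum_(b : JJ i) al b * G (update a b)).
  rewrite sum_al sum_be; set g := fun t => _.
  have Xg : @X i g by exact: f_slice.
  have I0 : 0 <= power_mean (mus i) p g.
    by rewrite fine_ge0 // integral_ge0 // => x _; rewrite lee_fin powR_ge0.
  have := xi_disc Xg; have := c_close Xg; rewrite ler_norml.
  rewrite /g; set I := power_mean _ _ _ in I0 *; set Q := mean_power _ _ _.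
  set Y := (\sum_j _) / _ => /andP[h1 h2] /andP[h3 h4].
  apply/andP; split; lra.
rewrite cell_meanE grid_meanE; apply/andP; split.
  apply: hybrid_le => [|i b|i b|a i]; [lra|exact: al_ge0|exact: be_ge0|].
  by case/andP: (one a i).
have : (2 / 3) ^+ s * (\sum_(a : {dffun forall i, JJ i}) (\prod_i be (a i)) * G a) <=
    \sum_(a : {dffun forall i, JJ i}) (\prod_i al (a i)) * G a.
  apply: hybrid_le => [|i b|i b|a i]; [lra|exact: be_ge0|exact: al_ge0|].
  by case/andP: (one a i); lra.
move=> h; have : (3 / 2) ^+ s * (2 / 3) ^+ s = 1 :> R.
  by rewrite -exprMn (_ : 3 / 2 * (2 / 3) = 1) ?expr1n //; field.
move=> e1; rewrite -[leLHS](mul1r (\sum_a _ * _)) -[X in X * _]e1 -mulrA.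
by apply: ler_wpM2l => //; apply: exprn_ge0; lra.
Qed.

End Compare.
End Tensor.

Lemma tensor_osc (R : realType) (k : scalar_kind) s (T : 'I_s -> Type) n
    (c : 'I_n -> scalar_field R k) (h : 'I_n -> forall i, T i -> scalar_field R k)
    (S d : R) (x y : forall i, T i) : 1 <= S -> 0 <= d ->
  (forall l i t, modulus (h l i t) <= S) ->
  (forall l i, modulus (h l i (x i) - h l i (y i)) <= d) ->
  modulus (\sum_l c l * \prod_(i < s) h l i (x i) -
           \sum_l c l * \prod_(i < s) h l i (y i)) <=
  (\sum_l modulus (c l)) * (s%:R * S ^+ s * d).
Proof.
move=> S1 d0 hS hd; rewrite -sumrB mulr_suml.
apply: le_trans (modulus_sum _ _ _) _; apply: ler_sum => l _.
rewrite -mulrBr modulusM; apply: ler_wpM2l; first exact: modulus_ge0.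
have sz : size (index_enum 'I_s) = s by rewrite -[RHS]card_ord cardT enumT.
have := @modulus_prod_lip R k _ (index_enum 'I_s) (fun i => h l i (x i))
  (fun i => h l i (y i)) S d S1 d0 (fun i => hS l i _) (fun i => hS l i _) (hd l).
by rewrite sz.
Qed.

Lemma tensor_bounded (R : realType) (k : scalar_kind) s (T : 'I_s -> Type) n
    (c : 'I_n -> scalar_field R k) (h : 'I_n -> forall i, T i -> scalar_field R k)
    (S : R) (x : forall i, T i) : 1 <= S ->
  (forall l i t, modulus (h l i t) <= S) ->
  modulus (\sum_l c l * \prod_(i < s) h l i (x i)) <= (\sum_l modulus (c l)) * S ^+ s.
Proof.
move=> S1 hS; rewrite mulr_suml.
apply: le_trans (modulus_sum _ _ _) _; apply: ler_sum => l _.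
rewrite modulusM; apply: ler_wpM2l; first exact: modulus_ge0.
have sz : size (index_enum 'I_s) = s by rewrite -[RHS]card_ord cardT enumT.
have := @modulus_prod_le R k _ (index_enum 'I_s) (fun i => h l i (x i)) S S1
  (fun i => hS l i _).
by rewrite sz.
Qed.

(** The finite sums over the product cells converge to the integral, while their
    comparison with the mean over the grid does not depend on the cells. *)
Theorem tensor_discretization (R : realType) (k : scalar_kind) (p : R) (s : nat)
    (Omega : 'I_s -> compact_domain R)
    (mus : forall i, probability (borel (points (Omega i))) R)
    (mu : probability (product_space (fun i => borel (points (Omega i)))) R)
    (N : 'I_s -> nat) (M : 'I_s -> R)
    (e : forall i, 'I_(N i) -> points (Omega i) -> scalar_field R k)
    (m : 'I_s -> nat) (xi : forall i, 'I_(m i) -> points (Omega i))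
    (X := fun i => span_of (range (e i))) :
  1 <= p -> is_product_measure mus mu ->
  (forall i, 1 <= M i) -> (forall i, lin_indep (e i)) ->
  (forall i g, X i g -> continuous g) ->
  (forall i g, X i g ->
    exists a : R, [/\ (\int[mus i]_x ((modulus (g x)) `^ p)%:E)%E = a%:E, 0 <= a &
    forall x, modulus (g x) `^ p <= M i * a]) ->
  (forall i, (0 < m i)%N) ->
  (forall i g, X i g ->
    3 / 4 * power_mean (mus i) p g <= (\sum_j modulus (g (xi i j)) `^ p) / (m i)%:R <=
    4 / 3 * power_mean (mus i) p g) ->
  forall f, tensor_space X f -> exists2 r : R,
    (\int[mu]_x ((modulus (f x)) `^ p)%:E)%E = r%:E &
    (1 / 2) ^+ s * r <= grid_mean p xi f <= (3 / 2) ^+ s * r.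
Proof.
move=> p1 mu_prod M1 e_ind e_cont nik m0 xiP f [n [cf [g0 [g0P fE]]]].
have p0 : 0 < p by lra.
have [h hP] := choice g0P.
have {}fE : f = fun x => \sum_(l < n) cf l * \prod_(i < s) h l i (x i).
  rewrite fE; apply/funext => x; apply: eq_bigr => l _.
  by have [_ ->] := hP l.
have hX l i : X i (h l i) by have [] := hP l.
have slice x i : X i (fun t => f (dfwith x i t)).
  have -> : (fun t => f (dfwith x i t)) =
      fun t => \sum_(l < n) (cf l * \prod_(j < s | j != i) h l j (x j)) * h l i t.
    apply/funext => t; rewrite fE; apply: eq_bigr => l _.
    rewrite (bigD1 i) //= dfwithin [h l i t * _]mulrC mulrA; congr (_ * _ * _).
    by apply: eq_bigr => j ji; rewrite dfwithout // eq_sym.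
  by apply: span_of_sum => l; exact: hX.
have bounds (li : 'I_n * 'I_s) : exists b : R, forall t, modulus (h li.1 li.2 t) <= b.
  by apply: continuous_modulus_bounded; apply: e_cont; exact: hX.
have [B BP] := choice bounds.
pose S := 1 + \sum_li `|B li|.
have S1 : 1 <= S by rewrite lerDl sumr_ge0.
have hS l i t : modulus (h l i t) <= S.
  apply: le_trans (BP (l, i) t) _; apply: le_trans (ler_norm _) _.
  rewrite /S (bigD1 (l, i)) //= addrCA lerDl addr_ge0 ?sumr_ge0 //.
pose D := \sum_l modulus (cf l).
have D0 : 0 <= D by apply: sumr_ge0 => l _; exact: modulus_ge0.
have fS x : modulus (f x) <= D * S ^+ s by rewrite fE; exact: tensor_bounded.
have Ss0 : 0 <= S ^+ s by apply: exprn_ge0; lra.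
pose K := p * (D * S ^+ s) `^ (p - 1) * (D * (s%:R * S ^+ s * S)).
have K0 : 0 <= K.
  have S0 : 0 <= S by lra.
  by rewrite /K !mulr_ge0 ?powR_ge0 // ltW.
have approx eta : 0 < eta -> eta <= 1 / 10 -> exists r Q : R,
    [/\ (\int[mu]_x ((modulus (f x)) `^ p)%:E)%E = r%:E, `|r - Q| <= K * eta &
        (1 / 2) ^+ s * Q <= grid_mean p xi f <= (3 / 2) ^+ s * Q].
  move=> eta0 eta10.
  have cells i := cid (uniform_cells p1 (M1 i) (e_ind i) (@e_cont i) (@nik i) eta0).
  pose J i : finType := projT1 (cells i).
  have cells' i := cid (projT2 (cells i)).
  pose c i : borel (points (Omega i)) -> J i := projT1 (cells' i).
  have c_meas i a : measurable (c i @^-1` [set a]) by have [+ _ _] := projT2 (cells' i); apply.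
  have c_osc i u : X i u -> (forall x, modulus (u x) <= S) ->
      forall x y, c i x = c i y -> modulus (u x - u y) <= eta * S.
    by have [_ + _] := projT2 (cells' i); apply.
  have c_close i u : X i u ->
      `|power_mean (mus i) p u -
        mean_power (cell_weight (mus i) (c i)) p (u \o cell_point (c i))| <=
      1 / 10 * power_mean (mus i) p u.
    have [_ _ cl] := projT2 (cells' i); move=> /cl h1; apply: le_trans h1 _.
    by apply: ler_wpM2r => //; rewrite fine_ge0 // integral_ge0 // => x _; rewrite lee_fin powR_ge0.
  pose H (a : {dffun forall i, J i}) := modulus (f (fun i => cell_point (c i) (a i))) `^ p.
  have [||||r rE rP] := @integral_cells _ _ R mu {dffun forall i, J i} (product_cell c)
     (measurable_product_cell c_meas) (fun x => modulus (f x) `^ p) H (K * eta).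
  - by rewrite mulr_ge0 // ltW.
  - by move=> x; exact: powR_ge0.
  - by move=> a; exact: powR_ge0.
  - move=> x; apply: le_trans (powR_lipschitz (S := D * S ^+ s) p1 _ _) _; rewrite ?modulus_ge0 ?fS //.
    rewrite /K -[leRHS]mulrA; apply: ler_wpM2l; first by rewrite mulr_ge0 ?powR_ge0 // ltW.
    apply: le_trans (modulusB_lip _ _) _.
    have -> : D * (s%:R * S ^+ s * S) * eta = D * (s%:R * S ^+ s * (eta * S)) by ring.
    rewrite fE; apply: tensor_osc => //; first by rewrite mulr_ge0; lra.
    move=> l i; apply: c_osc => //.
    by rewrite ffunE cell_pointP.
  exists r, (cell_mean p mus c f); split => //.
    move: rP; congr (`|_ - _| <= _); apply: eq_bigr => a _.
    by rewrite (product_cell_weight mu_prod c_meas).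
  exact: (@grid_mean_cell_mean R k p s Omega mus X m xi m0 xiP J c c_close f slice).
have [r [Q [rE _ _]]] := approx (1 / 10) ltac:(lra) ltac:(lra).
exists r => //.
have limit e0 : 0 < e0 -> exists eta : R, [/\ 0 < eta, eta <= 1 / 10 & K * eta <= e0].
  move=> e00; exists (Num.min (1 / 10) (e0 / (K + 1))).
  have K1 : 0 < K + 1 by lra.
  split; first by rewrite lt_min; apply/andP; split; [lra|exact: divr_gt0].
    by rewrite ge_min lexx.
  apply: (@le_trans _ _ (K * (e0 / (K + 1)))).
    by apply: ler_wpM2l => //; rewrite ge_min lexx orbT.
  by rewrite mulrA ler_pdivrMr // mulrC ler_pM2l //; lra.
have near e0 : 0 < e0 -> exists Q : R, `|r - Q| <= e0 /\
    (1 / 2) ^+ s * Q <= grid_mean p xi f <= (3 / 2) ^+ s * Q.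
  move=> /limit[eta [eta0 eta1 etaK]].
  have [r' [Q' [r'E r'Q QP]]] := approx eta eta0 eta1.
  have rr : r' = r by have := rE; rewrite r'E => -[].
  by exists Q'; split => //; rewrite -rr; exact: le_trans etaK.
have h1 : 0 < (1 / 2 : R) ^+ s by apply: exprn_gt0; lra.
have h2 : 0 < (3 / 2 : R) ^+ s by apply: exprn_gt0; lra.
apply/andP; split; apply/ler_addgt0Pr => e0 e00.
  have [Q' []] := near (e0 / (1 / 2) ^+ s) (divr_gt0 e00 h1).
  rewrite ler_norml => /andP[_ q1] /andP[q2 _].
  have : (1 / 2) ^+ s * (r - Q') <= e0 by rewrite mulrC -ler_pdivlMr.
  rewrite mulrBr; lra.
have [Q' []] := near (e0 / (3 / 2) ^+ s) (divr_gt0 e00 h2).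
rewrite ler_norml => /andP[q1 _] /andP[_ q2].
have : (3 / 2) ^+ s * (Q' - r) <= e0.
  by rewrite mulrC -ler_pdivlMr //; move: q1; set u := e0 / _; lra.
rewrite mulrBr; lra.
Qed.

Theorem proposition3p2 (R : realType) (p q : R) (s : nat)
    (hq : 2 <= q) (hqp : q <= p) (hs : (0 < s)%N) :
  exists2 C : R, 0 < C &
  forall (k : scalar_kind) (Omega : 'I_s -> compact_domain R)
    (mus : forall i, probability (borel (points (Omega i))) R)
    (mu : probability (product_space (fun i => borel (points (Omega i)))) R)
    (N : 'I_s -> nat) (B : 'I_s -> R)
    (X : forall i, set (points (Omega i) -> scalar_field R k)),
    is_product_measure mus mu ->
    (forall i, (0 < N i)%N) ->
    (forall i, 1 <= B i) ->
    (forall i f, X i f -> continuous f) ->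
    (forall i, subspace_of_dim (N i) (X i)) ->
    (forall i f, X i f ->
      (uniform_norm f <=
         (B i * (N i)%:R `^ q^-1)%:E * lp_norm (mus i) q f)%E) ->
  exists (m : 'I_s -> nat) (xi : forall i, 'I_(m i) -> points (Omega i)),
    [/\ forall i, (0 < m i)%N,
        (\prod_(i < s) m i)%:R <=
          C * \prod_(i < s) (B i `^ p * (N i)%:R `^ (p / q) *
                             log2 (2 * B i * (N i)%:R) ^+ 3)
      & forall f, tensor_space X f ->
          let discrete_mean : R := (\prod_(i < s) m i)%:R^-1 *
            \sum_(j : {dffun forall i : 'I_s, 'I_(m i)})
              modulus (f (tensor_points xi j)) `^ p in
          (((1 / 2) ^+ s)%:E * lp_norm mu p f `^ p <= discrete_mean%:E)%E /\
          (discrete_mean%:E <= ((3 / 2) ^+ s)%:E * lp_norm mu p f `^ p)%E].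
Proof.
have p2 : 2 <= p by exact: le_trans hqp.
have p1 : 1 <= p by lra.
have q1 : 1 <= q by lra.
have [C1 C10 factor] := factor_discretization p2.
have C0 : 0 < C1 * (1 + p) ^+ 3 by rewrite mulr_gt0 // exprn_gt0 //; lra.
exists ((C1 * (1 + p) ^+ 3) ^+ s); first exact: exprn_gt0.
move=> k Omega mus mu N B X mu_prod N0 B1 X_cont X_dim X_nik.
pose e i := projT1 (cid2 (X_dim i)).
have e_ind i : lin_indep (e i) by rewrite /e; case: cid2.
have XE i : X i = span_of (range (e i)) by rewrite /e; case: cid2.
pose M i := B i `^ p * (N i)%:R `^ (p / q).
have pq1 : 1 <= p / q by rewrite ler_pdivlMr; lra.
have NM i : (N i)%:R <= M i.
  have N1 : (1 : R) <= (N i)%:R by rewrite ler1n.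
  apply: le_trans (le1r_powR N1 pq1) _; rewrite ler_peMl ?powR_ge0 //.
  exact: le_trans (B1 i) (le1r_powR (B1 i) p1).
have M1 i : 1 <= M i by apply: le_trans (NM i); rewrite ler1n.
have e_cont i g : span_of (range (e i)) g -> continuous g.
  by rewrite -XE; exact: X_cont.
have e_nik i g : span_of (range (e i)) g ->
    exists a : R, [/\ (\int[mus i]_x ((modulus (g x)) `^ p)%:E)%E = a%:E, 0 <= a &
    forall x, modulus (g x) `^ p <= M i * a].
  move=> gs; apply: (@factor_nikolskii R k (Omega i) (mus i) p q (B i) (N i)) => //.
  - by apply: le_trans (B1 i).
  - exact: e_cont.
  - by apply: X_nik; rewrite XE.
have points_ex i := cid (factor k (Omega i) (mus i) (N i) (M i) (e i) (N0 i) (M1 i)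
  (NM i) (e_ind i) (@e_cont i) (@e_nik i)).
pose m i := projT1 (points_ex i).
have xi_ex i := cid (projT2 (points_ex i)).
pose xi i : 'I_(m i) -> points (Omega i) := projT1 (xi_ex i).
have m_gt0 i : (0 < m i)%N by have [] := projT2 (xi_ex i).
exists m, xi; split => // [|f].
  rewrite natr_prod.
  have -> : (C1 * (1 + p) ^+ 3) ^+ s = \prod_(i < s) (C1 * (1 + p) ^+ 3).
    by rewrite prodr_const card_ord.
  rewrite -big_split /=; apply: ler_prod => i _; rewrite ler0n /=.
  have [_ mM _] := projT2 (xi_ex i); apply: le_trans mM _.
  have -> : C1 * (1 + p) ^+ 3 *
      (B i `^ p * (N i)%:R `^ (p / q) * log2 (2 * B i * (N i)%:R) ^+ 3) =
      C1 * M i * ((1 + p) * log2 (2 * B i * (N i)%:R)) ^+ 3 by rewrite /M; ring.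
  have l0 : 0 <= 1 + ln (M i) by rewrite addr_ge0 // ln_ge0.
  have lM : 1 + ln (M i) <= (1 + p) * log2 (2 * B i * (N i)%:R).
    exact: le_log2.
  apply: ler_wpM2l; first by rewrite mulr_ge0 // ltW //; apply: lt_le_trans (M1 i).
  by apply: lerXn2r => //; rewrite nnegrE //; exact: le_trans lM.
have XE' : X = fun i => span_of (range (e i)).
  by apply: functional_extensionality_dep => i; rewrite XE.
rewrite {}XE' => fX.
have [r rE /andP[lo up]] := @tensor_discretization R k p s Omega mus mu N M e m xi p1
  mu_prod M1 e_ind e_cont e_nik m_gt0
  (fun i g gX => let: And3 _ _ h := projT2 (xi_ex i) in h g gX) f fX.
rewrite lp_norm_powE ?rE; last by rewrite gt_eqF //; lra.
by split; rewrite -EFinM lee_fin.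
Qed.
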